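(* For every $n\ge 0$ and every pointed graph $(G,v)$ there is an isomorphism $A_n(G,v)\cong\pi_n(\mathrm{N}G,v)$, natural in $(G,v)$ (an isomorphism of groups for $n\ge1$ and of pointed sets for $n=0$).
   Context: Graphs. A graph is a (possibly infinite) simple undirected graph without loops; write $v\sim w$ if $v,w$ are equal or joined by an edge. A graph map $f\colon G\to H$ is a function on vertices such that $v\sim w$ implies $f(v)\sim f(w)$. The product $G\otimes H$ has as vertices the pairs $(v,w)$, with $(v,w)\sim(v',w')$ iff ($v=v'$ and $w\sim w'$) or ($w=w'$ and $v\sim v'$); $G^{\otimes n}$ is the $n$-fold product, and $G^{\otimes 0}$ is the one-vertex graph $I_0$. $I_m$ has vertices $0,\dots,m$ and edges between $i$ and $i+1$; $I_\infty$ has vertex set $\mathbb{Z}$ and edges between $i$ and $i+1$. A pointed graph $(G,v)$ is a graph with a chosen vertex. A-groups. For $M\ge0$ let $I^{\otimes n}_{\ge M}$ be the subgraph of $I_\infty^{\otimes n}$ on vertices with $|v_i|\ge M$ for some $i$. Consider graph maps $f\colon I_\infty^{\otimes n}\to G$ which are constant at $v$ on $I^{\otimes n}_{\ge M}$ for some $M$. A based homotopy from $f$ to $g$ is a graph map $\eta\colon I_\infty^{\otimes n}\otimes I_m\to G$, for some $m\ge0$, restricting to $f$ on $I_\infty^{\otimes n}\otimes\{0\}$, to $g$ on $I_\infty^{\otimes n}\otimes\{m\}$, and constant at $v$ on $I^{\otimes n}_{\ge K}\otimes I_m$ for some $K$. $A_n(G,v)$ is the set of based homotopy classes of such maps, pointed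 by the constant map. For $n\ge1$ it is a group: if $f,g$ are constant at $v$ on $I^{\otimes n}_{\ge M}$, $I^{\otimes n}_{\ge M'}$ respectively, then $[f][g]$ is the class of the map equal to $f(v_1,\dots,v_n)$ if $v_i\le M$ and to $g(v_1,\dots,v_i-M-M',\dots,v_n)$ if $v_i>M$ (independent of the choice of $i\in\{1,\dots,n\}$). Cubical sets. The box category $\square$ has objects the posets $[1]^n=\{0\le1\}^n$, $n\ge0$, with morphisms generated by: faces $\partial_{i,\varepsilon}\colon[1]^{n-1}\to[1]^n$ inserting $\varepsilon\in\{0,1\}$ in position $i$; degeneracies $\sigma_i\colon[1]^n\to[1]^{n-1}$ deleting the $i$-th coordinate; connections $\gamma_{i,0},\gamma_{i,1}\colon[1]^n\to[1]^{n-1}$ replacing $x_i,x_{i+1}$ by their max and min respectively. A cubical set is a presheaf $X$ on $\square$, $X_n=X([1]^n)$, and operators act on the right. $\square^n$ is the representable presheaf of $[1]^n$; the open box $\sqcap^n_{i,\varepsilon}\subseteq\square^n$ ($n\ge1$, $1\le i\le n$) is the union of the images of all faces $\partial_{j,\eta}$, $(j,\eta)\neq(i,\varepsilon)$. $X$ is a Kan complex if every map $\sqcap^n_{i,\varepsilon}\to X$ extends to $\square^n$. Homotopy groups of a pointed Kan complex $(X,x)$. $\pi_n(X,x)$ is the set of relative homotopy classes of relative maps $(\square^n,\partial\square^n)\to(X,x)$, i.e. of $n$-cubes $u\in X_n$ all of whose faces are the totally degenerate cube at $x$, where $u,u'$ are homotopic if there is $h\in X_{n+1}$ with $h\partial_{n+1,0}=u$,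 $h\partial_{n+1,1}=u'$ and all other faces totally degenerate at $x$ (an equivalence relation for Kan complexes). For $n=1$ the product is $[u][u']=[w]$ whenever there is $\eta\in X_2$ with $\eta\partial_{1,0}=u$, $\eta\partial_{1,1}=u'\partial_{1,1}\sigma_1$, $\eta\partial_{2,1}=u'$, $\eta\partial_{2,0}=w$. For $n\ge2$ the group structure is transported along the bijection $\pi_n(X,x)\cong\pi_1(\Omega^{n-1}(X,x))$, where $\Omega(X,x)$ is the Kan complex whose $k$-cubes are the $y\in X_{k+1}$ with $y\partial_{1,0}$ and $y\partial_{1,1}$ totally degenerate at $x$ (with operators acting on the last $k$ coordinates). Nerve. A graph map $f\colon I_\infty^{\otimes n}\to G$ is stable in all directions if there is $M\ge0$ such that for every $i$, the value of $f$ is unchanged when a coordinate $v_i>M$ is replaced by $M$ and when a coordinate $v_i<-M$ is replaced by $-M$. $\mathrm{N}G$ is the cubical set with $(\mathrm{N}G)_n$ the set of such maps, where $f\partial_{i,\varepsilon}$ is obtained by setting the $i$-th coordinate of $f$ equal to $(2\varepsilon-1)M$ for $M$ as in the stability condition, $f\sigma_i(v_1,\dots,v_{n+1})=f(v_1,\dots,v_{i-1},v_{i+1},\dots,v_{n+1})$, and $f\gamma_{i,0}$, $f\gamma_{i,1}$ send $(v_1,\dots,v_{n+1})$ to $f(v_1,\dots,v_{i-1},\max(v_i,v_{i+1}),v_{i+2},\dots)$ and $f(v_1,\dots,v_{i-1},\min(v_i,v_{i+1}),v_{i+2},\dots)$ respectively. It is a known fact that $\mathrm{N}G$ is a Kan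 complex for every graph $G$, so $\pi_n(\mathrm{N}G,v)$ is defined, where $v$ is regarded as a $0$-cube. *)

(* Defs.v *)
From HB Require Import structures.
From mathcomp Require Import all_boot all_order all_algebra zify.
From mathcomp Require Import boolp.

Set Implicit Arguments.
Unset Strict Implicit.
Unset Printing Implicit Defensive.
Import Order.TTheory GRing.Theory Num.Theory.

Lemma sig_eq T (P : T -> Prop) (s t : {x | P x}) :
  proj1_sig s = proj1_sig t -> s = t.
Proof. by case: s t => [s hs] [t ht] /=; exact: eq_exist. Qed.

(* The set of [R]-classes: a class is a set of the form [R x]. *)
Record quot (T : Type) (R : T -> T -> Prop) : Type :=
  Quot { qset : T -> Prop ; qsetP : exists x, qset = R x }.

Definition class (T : Type) (R : T -> T -> Prop) (x : T) : quot R :=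
  Quot (ex_intro _ x erefl).

Definition repr (T : Type) (R : T -> T -> Prop) (a : quot R) : T :=
  proj1_sig (cid (qsetP a)).

Record equiv (T : Type) (R : T -> T -> Prop) : Prop := Equiv {
  equiv_refl : forall x, R x x ;
  equiv_sym : forall x y, R x y -> R y x ;
  equiv_trans : forall x y z, R x y -> R y z -> R x z }.

Lemma equiv_eucl (T : Type) (R : T -> T -> Prop) :
  (forall x, R x x) -> (forall x y z, R x y -> R x z -> R y z) -> equiv R.
Proof.
move=> Rr Re; have Rs x y : R x y -> R y x by move=> /Re; apply; exact: Rr.
by split=> // x y z /Rs; exact: Re.
Qed.

Lemma quot_eq T (R : T -> T -> Prop) (a b : quot R) : qset a = qset b -> a = b.
Proof.
by case: a b => [a ha] [b hb] /= e; rewrite e in ha *; rewrite (Prop_irrelevance ha hb).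
Qed.

Lemma classE T (R : T -> T -> Prop) (x y : T) :
  equiv R -> class R x = class R y <-> R x y.
Proof.
case=> Rr Rs Rt; split=> [[e]|xy]; first by rewrite e.
apply: quot_eq; apply: funext => z /=; apply: propext.
by split; apply: Rt => //; apply: Rs.
Qed.

Lemma reprK T (R : T -> T -> Prop) (a : quot R) : class R (repr a) = a.
Proof. by apply: quot_eq => /=; rewrite /repr; case: cid. Qed.

Lemma quotP T (R : T -> T -> Prop) (P : quot R -> Prop) :
  (forall x, P (class R x)) -> forall a, P a.
Proof. by move=> h a; rewrite -(reprK a). Qed.

Lemma repr_class T (R : T -> T -> Prop) (x : T) : equiv R -> R (repr (class R x)) x.
Proof. by move=> Re; apply/(classE _ _ Re); rewrite reprK. Qed.

(* [edge] is adjacency of distinct vertices; [adj] is the reflexive relation ~. *)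
Record graph : Type := Graph {
  vertex :> Type ;
  edge : vertex -> vertex -> Prop ;
  edge_sym : forall v w, edge v w -> edge w v ;
  edge_irrefl : forall v, ~ edge v v }.

Definition adj (G : graph) (v w : G) : Prop := v = w \/ edge v w.

Lemma adj_refl (G : graph) (v : G) : adj v v. Proof. by left. Qed.
Lemma adj_sym (G : graph) (v w : G) : adj v w -> adj w v.
Proof. by case=> [->|/edge_sym]; [left|right]. Qed.
#[global] Hint Resolve adj_refl : core.

Record gmap (G H : graph) : Type := GMap {
  gmap_fun :> G -> H ;
  gmapP : forall v w, adj v w -> adj (gmap_fun v) (gmap_fun w) }.

Lemma gmap_eq G H (f g : gmap G H) : f =1 g -> f = g.
Proof.
case: f g => [f hf] [g hg] /= /funext e; rewrite e in hf *.
by rewrite (Prop_irrelevance hf hg).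
Qed.

Definition gmap_comp (G H K : graph) (g : gmap H K) (f : gmap G H) : gmap G K :=
  GMap (fun v w vw => gmapP g (gmapP f vw)).

Definition gmap_const (G H : graph) (h : H) : gmap G H :=
  @GMap G H (fun _ => h) (fun _ _ _ => adj_refl h).

Section Product.
Variables G H : graph.

Definition prod_edge (p q : G * H) : Prop :=
  (p.1 = q.1 /\ edge p.2 q.2) \/ (p.2 = q.2 /\ edge p.1 q.1).

Lemma prod_edge_sym p q : prod_edge p q -> prod_edge q p.
Proof. by case=> -[e /edge_sym ?]; [left|right]. Qed.

Lemma prod_edge_irrefl p : ~ prod_edge p p.
Proof. by case=> -[_]; apply: edge_irrefl. Qed.

Definition prod_graph : graph := Graph prod_edge_sym prod_edge_irrefl.

Lemma adj_prod (p q : prod_graph) :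
  adj p q <-> (p.1 = q.1 /\ adj p.2 q.2) \/ (p.2 = q.2 /\ adj p.1 q.1).
Proof.
case: p q => [p1 p2] [q1 q2]; split; rewrite /adj /= /prod_edge /=.
  case=> [[-> ->]|]; first by left; split=> //; left.
  by case=> -[-> e]; [left|right]; split=> //; right.
by case=> -[-> [->|e]]; [left|right; left|left|right; right].
Qed.
End Product.

(* [pow G n] is the [n]-fold product of [G] in unbiased form: vertices are
   [n]-tuples, and an edge changes exactly one coordinate, along an edge. *)
Section Power.
Variables (G : graph) (n : nat).

Definition pow_edge (v w : 'I_n -> G) : Prop :=
  exists i, edge (v i) (w i) /\ forall j, j != i -> v j = w j.

Lemma pow_edge_sym v w : pow_edge v w -> pow_edge w v.
Proof. by case=> i [/edge_sym e h]; exists i; split=> // j /h. Qed.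

Lemma pow_edge_irrefl v : ~ pow_edge v v.
Proof. by case=> i [/edge_irrefl]. Qed.

Definition pow : graph := Graph pow_edge_sym pow_edge_irrefl.

Lemma adj_pow (v w : pow) i :
  adj (v i) (w i) -> (forall j, j != i -> v j = w j) -> adj v w.
Proof.
case=> [e|e] h; [left|by right; exists i].
by apply: funext => j; have [->|/h] := eqVneq j i.
Qed.

Lemma adj_powP (v w : pow) (P : Prop) :
  (v = w -> P) ->
  (forall i, adj (v i) (w i) -> (forall j, j != i -> v j = w j) -> P) ->
  adj v w -> P.
Proof. by move=> h1 h2 [/h1//|[i [e h]]]; apply: (h2 i) => //; right. Qed.
End Power.

Section Intervals.
Local Open Scope ring_scope.

Definition Iinf_edge (a b : int) : Prop := b = a + 1 \/ a = b + 1.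

Lemma Iinf_edge_sym a b : Iinf_edge a b -> Iinf_edge b a.
Proof. by case; [right|left]. Qed.

Lemma Iinf_edge_irrefl a : ~ Iinf_edge a a.
Proof. by case; lia. Qed.

Definition Iinf : graph := Graph Iinf_edge_sym Iinf_edge_irrefl.

Lemma adj_Iinf (a b : Iinf) : adj a b <-> (`|(a : int) - b| <= 1)%R.
Proof.
rewrite /adj /= /Iinf_edge; split; first by move=> [->|]; lia.
move=> h; have [->|ne] := eqVneq (a : int) b; [by left|right].
have {}ne : (a : int) <> b by move/eqP: ne.
by lia.
Qed.

Variable m : nat.

(* [I_ m] has the m + 1 vertices 0, ..., m. *)
Definition I_edge (a b : 'I_m.+1) : Prop := (a.+1 = b \/ b.+1 = a)%N.

Lemma I_edge_sym a b : I_edge a b -> I_edge b a.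
Proof. by case; [right|left]. Qed.

Lemma I_edge_irrefl a : ~ I_edge a a.
Proof. by case; lia. Qed.

Definition I_ : graph := Graph I_edge_sym I_edge_irrefl.
End Intervals.

Notation grid n := (pow Iinf n).

Record pgraph : Type := PGraph { pgraph_graph :> graph ; pt : pgraph_graph }.

Record pgmap (G H : pgraph) : Type := PGMap {
  pgmap_map :> gmap G H ; pgmap_pt : pgmap_map (pt G) = pt H }.

Section Coordinates.
Variables (T : Type) (n : nat).

Definition ins (i : 'I_n) (a : T) (x : 'I_n.-1 -> T) : 'I_n -> T :=
  fun j => if unlift i j is Some k then x k else a.

Definition del (i : 'I_n) (x : 'I_n -> T) : 'I_n.-1 -> T := fun j => x (lift i j).

Definition upd (i : 'I_n) (a : T) (x : 'I_n -> T) : 'I_n -> T :=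
  fun j => if j == i then a else x j.

(* Replaces the entries at positions [i] and [i + 1] by their image by [op]. *)
Definition conn (op : T -> T -> T) (i : 'I_n) (x : 'I_n.+1 -> T) : 'I_n -> T :=
  fun j => if j == i then op (x (widen_ord (leqnSn n) i)) (x (lift ord0 i))
           else x (lift (lift ord0 i) j).
End Coordinates.

Lemma ins_lift T n (i : 'I_n) (a : T) x k : ins i a x (lift i k) = x k.
Proof. by rewrite /ins liftK. Qed.

Lemma ins_same T n (i : 'I_n) (a : T) x : ins i a x i = a.
Proof. by rewrite /ins unlift_none. Qed.

Lemma liftP T n (i : 'I_n) (f g : 'I_n -> T) :
  f i = g i -> (forall k, f (lift i k) = g (lift i k)) -> f = g.
Proof.
by move=> h1 h2; apply: funext => j; case: (unliftP i j) => [k ->|->].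
Qed.

Lemma ins_del T n (i : 'I_n) (x : 'I_n -> T) : ins i (x i) (del i x) = x.
Proof. by apply: (@liftP _ _ i) => [|k]; rewrite ?ins_same ?ins_lift. Qed.

Lemma del_ins T n (i : 'I_n) (a : T) x : del i (ins i a x) = x.
Proof. by apply: funext => k; rewrite /del ins_lift. Qed.

Notation cube n := ('I_n -> bool).

(* Coordinates are numbered from 0, and [false], [true] stand for 0, 1.  The
   connections replace two consecutive coordinates by their max ([e = false],
   [orb]) or their min ([e = true], [andb]). *)
Inductive box_gen : forall m n, (cube m -> cube n) -> Prop :=
| box_id n : @box_gen n n id
| box_comp m n p (f : cube n -> cube p) (g : cube m -> cube n) :
    box_gen f -> box_gen g -> box_gen (f \o g)
| box_face n (i : 'I_n) (e : bool) : @box_gen n.-1 n (ins i e)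
| box_degen n (i : 'I_n) : @box_gen n n.-1 (del i)
| box_conn n (i : 'I_n) (e : bool) :
    @box_gen n.+1 n (conn (if e then andb else orb) i).

Record boxhom (m n : nat) : Type := BoxHom {
  boxfun :> cube m -> cube n ; boxfunP : box_gen boxfun }.

Lemma boxhom_eq m n (f g : boxhom m n) : f =1 g -> f = g.
Proof.
case: f g => [f hf] [g hg] /= /funext e; rewrite e in hf *.
by rewrite (Prop_irrelevance hf hg).
Qed.

Definition bid n : boxhom n n := BoxHom (box_id n).
Definition bcomp m n p (f : boxhom n p) (g : boxhom m n) : boxhom m p :=
  BoxHom (box_comp (boxfunP f) (boxfunP g)).
Definition bface n (i : 'I_n) (e : bool) : boxhom n.-1 n := BoxHom (box_face i e).
Definition bdegen n (i : 'I_n) : boxhom n n.-1 := BoxHom (box_degen i).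
Definition bconn n (i : 'I_n) (e : bool) : boxhom n.+1 n := BoxHom (box_conn i e).

Lemma bcompA m n p q (f : boxhom p q) (g : boxhom n p) (h : boxhom m n) :
  bcomp f (bcomp g h) = bcomp (bcomp f g) h.
Proof. exact: boxhom_eq. Qed.
Lemma bcomp1 m n (f : boxhom m n) : bcomp f (bid m) = f.
Proof. exact: boxhom_eq. Qed.
Lemma bcomp_id m n (f : boxhom m n) : bcomp (bid n) f = f.
Proof. exact: boxhom_eq. Qed.

Fixpoint bterm (n : nat) : boxhom n 0 :=
  if n is m.+1 then bcomp (bterm m) (@bdegen m.+1 ord0) else bid 0.

Lemma bterm_uniq n (f : boxhom n 0) : f = bterm n.
Proof. by apply: boxhom_eq => x; apply: funext => -[]. Qed.

(* [id x f : [1]^(m + 1) -> [1]^(n + 1)], leaving the first coordinate alone. *)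
Definition bshift_fun m n (f : cube m -> cube n) : cube m.+1 -> cube n.+1 :=
  fun x => @ins _ n.+1 ord0 (x ord0) (f (@del _ m.+1 ord0 x)).

Lemma box_shift m n (f : cube m -> cube n) : box_gen f -> box_gen (bshift_fun f).
Proof.
elim=> {m n f} [n|m n p f g _ hf _ hg|n i e|n i|n i e].
- suff -> : bshift_fun id = @id (cube n.+1) by apply: box_id.
  by apply: funext => x; apply: (@ins_del _ n.+1).
- suff -> : bshift_fun (f \o g) = bshift_fun f \o bshift_fun g by apply: box_comp.
  apply: funext => x; rewrite /bshift_fun /= ins_same; congr ins; congr f.
  by rewrite (@del_ins _ _.+1).
- case: n i => [[]//|n] i /=.
  suff -> : bshift_fun (ins i e) = ins (lift (@ord0 n.+1) i) e
    by exact: (@box_face n.+2).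
  apply: funext => x; apply: (@liftP _ n.+2 (lift ord0 i)).
    by rewrite ins_same /bshift_fun ins_lift ins_same.
  move=> k; rewrite ins_lift /bshift_fun.
  case: (unliftP (@ord0 n) k) => [k'|] ->{k}.
    have -> : lift (lift ord0 i) (lift (@ord0 n) k') = lift (@ord0 n.+1) (lift i k').
      by apply: val_inj; rewrite /= /bump; lia.
    by rewrite !ins_lift.
  have -> : lift (lift ord0 i) (@ord0 n) = @ord0 n.+1 by apply: val_inj.
  by rewrite ins_same.
- case: n i => [[]//|n] i /=.
  suff -> : bshift_fun (del i) = del (lift (@ord0 n.+1) i)
    by exact: (@box_degen n.+2).
  apply: funext => x; apply: (@liftP _ n.+1 ord0); rewrite /bshift_fun.
    by rewrite ins_same /del; congr x; apply: val_inj.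
  move=> k; rewrite (@ins_lift _ n.+1) /del; congr x; apply: val_inj => /=.
  by rewrite /bump; lia.
- suff -> : bshift_fun (conn (if e then andb else orb) i)
          = conn (if e then andb else orb) (lift (@ord0 n) i) by apply: box_conn.
  apply: funext => x; apply: (@liftP _ n.+1 ord0); rewrite /bshift_fun.
    rewrite ins_same /conn.
    have -> /= : (ord0 == lift (@ord0 n) i) = false by [].
    by congr x; apply: val_inj.
  move=> k; rewrite (@ins_lift _ n.+1) /conn (inj_eq (@lift_inj _ _)).
  case: eqP => [_|_]; last by rewrite /del; congr x; apply: val_inj; rewrite /= /bump; lia.
  by rewrite /del; f_equal; congr x; apply: val_inj.
Qed.

Definition bshift m n (f : boxhom m n) : boxhom m.+1 n.+1 :=
  BoxHom (box_shift (boxfunP f)).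

Lemma bshift_comp m n p (f : boxhom n p) (g : boxhom m n) :
  bshift (bcomp f g) = bcomp (bshift f) (bshift g).
Proof.
apply: boxhom_eq => x /=; rewrite /bshift_fun /= ins_same.
by rewrite (@del_ins _ n.+1).
Qed.

Lemma bshift_id n : bshift (bid n) = bid n.+1.
Proof. by apply: boxhom_eq => x /=; exact: (@ins_del _ n.+1). Qed.

Lemma bshift_face n (i : 'I_n.+1) e :
  bshift (bface i e) = @bface n.+2 (lift ord0 i) e.
Proof.
apply: boxhom_eq => x; apply: (@liftP _ n.+2 (lift ord0 i)).
  by rewrite /= ins_same /bshift_fun (@ins_lift _ n.+2) ins_same.
move=> k; rewrite /= ins_lift /bshift_fun.
case: (unliftP (@ord0 n) k) => [k'|] ->{k}.
  have -> : lift (lift ord0 i) (lift (@ord0 n) k') = lift (@ord0 n.+1) (lift i k').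
    by apply: val_inj; rewrite /= /bump; lia.
  by rewrite (@ins_lift _ n.+2) ins_lift.
have -> : lift (lift ord0 i) (@ord0 n) = @ord0 n.+1 by apply: val_inj.
by rewrite (@ins_same _ n.+2).
Qed.

(* A presheaf on the box category; [act] is the right action. *)
Record cset : Type := CSet {
  cells :> nat -> Type ;
  act : forall m n, boxhom m n -> cells n -> cells m ;
  act_id : forall n (x : cells n), act (bid n) x = x ;
  act_comp : forall m n p (f : boxhom n p) (g : boxhom m n) (x : cells p),
    act (bcomp f g) x = act g (act f x) }.

Definition face (X : cset) n (i : 'I_n) (e : bool) (x : X n) : X n.-1 :=
  act (bface i e) x.
Definition degen (X : cset) n (i : 'I_n) (x : X n.-1) : X n := act (bdegen i) x.
Definition tdegen (X : cset) n (x : X 0) : X n := act (bterm n) x.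

Record cmap (X Y : cset) : Type := CMap {
  cmap_fun :> forall n, X n -> Y n ;
  cmapP : forall m n (f : boxhom m n) (x : X n),
    cmap_fun (act f x) = act f (cmap_fun x) }.

Definition yoneda (n : nat) : cset :=
  @CSet (fun m => boxhom m n) (fun _ _ f x => bcomp x f)
    (fun _ x => bcomp1 x) (fun _ _ _ f g x => bcompA x f g).

Section OpenBox.
Variables (n : nat) (i : 'I_n) (e : bool).

Definition in_open_box m (x : boxhom m n) : Prop :=
  exists (j : 'I_n) (d : bool) (y : boxhom m n.-1),
    (j, d) <> (i, e) /\ x = bcomp (bface j d) y.

Definition open_box_cells m : Type := {x : boxhom m n | in_open_box x}.

Lemma open_box_subproof m p (f : boxhom m p) (x : boxhom p n) :
  in_open_box x -> in_open_box (bcomp x f).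
Proof. by case=> j [d [y [h ->]]]; exists j, d, (bcomp y f); rewrite bcompA. Qed.

Definition open_box_act m p (f : boxhom m p) (x : open_box_cells p) :
  open_box_cells m := exist _ _ (open_box_subproof f (proj2_sig x)).

Lemma open_box_act_id m (x : open_box_cells m) : open_box_act (bid m) x = x.
Proof. by case: x => x hx; apply: eq_exist; exact: bcomp1. Qed.

Lemma open_box_act_comp m p q (f : boxhom p q) (g : boxhom m p)
  (x : open_box_cells q) :
  open_box_act (bcomp f g) x = open_box_act g (open_box_act f x).
Proof. by apply: eq_exist; exact: bcompA. Qed.

Definition open_box : cset := CSet open_box_act_id open_box_act_comp.
End OpenBox.

Definition is_kan (X : cset) : Prop :=
  forall n (i : 'I_n) (e : bool) (f : cmap (open_box i e) X),
  exists g : cmap (yoneda n) X,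
  forall m (x : open_box i e m), g m (proj1_sig x) = f m x.

Lemma face_act (X : cset) m n (i : 'I_n) e (f : boxhom m n.-1) (x : X n) :
  act f (face i e x) = act (bcomp (bface i e) f) x.
Proof. by rewrite act_comp. Qed.

Lemma act_tdegen (X : cset) m n (f : boxhom m n) (x : X 0) :
  act f (tdegen n x) = tdegen m x.
Proof. by rewrite /tdegen -act_comp; congr act; apply: bterm_uniq. Qed.

Lemma tdegen0 (X : cset) (x : X 0) : tdegen 0 x = x.
Proof. by rewrite /tdegen -(bterm_uniq (bid 0)) act_id. Qed.

Lemma bface_comm p (j k : 'I_p.+1) d e : (j <= k)%N ->
  bcomp (@bface p.+2 (lift ord0 k) e) (@bface p.+1 j d) =
  bcomp (@bface p.+2 (widen_ord (leqnSn _) j) d) (@bface p.+1 k e).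
Proof.
move=> jk; apply: boxhom_eq => x /=; apply: (@liftP _ p.+2 (lift ord0 k)).
  rewrite ins_same.
  have -> : lift ord0 k = lift (widen_ord (leqnSn _) j) k.
    by apply: val_inj; rewrite /= /bump; lia.
  by rewrite ins_lift ins_same.
move=> l; rewrite (@ins_lift _ p.+2); case: (unliftP j l) => [l'|] ->.
  rewrite ins_lift.
  have -> : lift (lift ord0 k) (lift j l') = lift (widen_ord (leqnSn _) j) (lift k l').
    by apply: val_inj; rewrite /= /bump; lia.
  by rewrite !ins_lift.
rewrite ins_same.
have -> : lift (lift ord0 k) j = widen_ord (leqnSn _) j.
  by apply: val_inj; rewrite /= /bump; lia.
by rewrite ins_same.
Qed.

Lemma bface_inj m n (i : 'I_n) d e (f g : boxhom m n.-1) :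
  bcomp (bface i d) f = bcomp (bface i e) g -> d = e /\ f = g.
Proof.
move=> h; split.
  have := congr1 (fun q : boxhom m n => q (fun _ => false) i) h.
  by rewrite /= !ins_same.
apply: boxhom_eq => x; have := congr1 (fun q : boxhom m n => del i (q x)) h.
by rewrite /= !del_ins.
Qed.

(* Matching families of faces: another description of the maps out of an open
   box. *)
Definition matching (X : cset) n (i : 'I_n) e (u : 'I_n -> bool -> X n.-1) : Prop :=
  forall j d k d' m (f g : boxhom m n.-1),
    (j, d) <> (i, e) -> (k, d') <> (i, e) ->
    bcomp (bface j d) f = bcomp (bface k d') g -> act f (u j d) = act g (u k d').

Lemma matching_faces (X : cset) p (i : 'I_p.+2) e (u : 'I_p.+2 -> bool -> X p.+1) :
  (forall (j k : 'I_p.+1) d d', (j <= k)%N ->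
    (widen_ord (leqnSn _) j, d) <> (i, e) -> (lift ord0 k, d') <> (i, e) ->
    face j d (u (lift ord0 k) d') = face k d' (u (widen_ord (leqnSn _) j) d)) ->
  @matching X p.+2 i e u.
Proof.
move=> hu; suff hlt (j k : 'I_p.+2) d d' m (f g : boxhom m p.+1) : (j < k)%N ->
    (j, d) <> (i, e) -> (k, d') <> (i, e) ->
    bcomp (@bface p.+2 j d) f = bcomp (@bface p.+2 k d') g ->
    act f (u j d) = act g (u k d').
  move=> j d k d' m f g hj hk h; have [jk|kj|/val_inj jk] := ltngtP j k.
  - exact: hlt h.
  - by apply/esym; apply: hlt (esym h).
  - by move: h; rewrite jk => /bface_inj [-> ->].
move=> jk; case: (unliftP ord0 k) => [k' ek|ek]; last by rewrite ek in jk.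
have jlt : (j < p.+1)%N by have := ltn_ord k; move: jk; lia.
pose j' := Ordinal jlt; have ej : j = widen_ord (leqnSn _) j' by apply: val_inj.
rewrite ek ej in jk *; move=> hj hk h.
have jk' : (j' <= k')%N by move: jk; rewrite /= /bump; lia.
clearbody j'; rewrite /= in jk'; pose q : boxhom m p := bcomp (@bdegen p.+1 j') g.
have eq1 : bcomp (@bdegen p.+2 (widen_ord (leqnSn _) j'))
      (bcomp (bface (lift ord0 k') d') g) = bcomp (@bface p.+1 k' d') q.
  apply: boxhom_eq => x; apply: (@liftP _ p.+1 k') => /=.
    rewrite ins_same /del.
    have -> : lift (widen_ord (leqnSn _) j') k' = lift ord0 k'.
      by apply: val_inj; rewrite /= /bump; lia.
    by rewrite ins_same.
  move=> l; rewrite (@ins_lift _ p.+1) /del.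
  have -> : lift (widen_ord (leqnSn _) j') (lift k' l) = lift (lift ord0 k') (lift j' l).
    by apply: val_inj; rewrite /= /bump; lia.
  by rewrite (@ins_lift _ p.+2).
have ef : f = bcomp (@bface p.+1 k' d') q.
  rewrite -eq1 -h bcompA; apply: boxhom_eq => x /=.
  by rewrite (@del_ins _ p.+2).
have eg : g = bcomp (@bface p.+1 j' d) q.
  have := h; rewrite ef bcompA -bface_comm // -bcompA => h'.
  by have [_ ->] := bface_inj h'.
rewrite {1}ef {1}eg !act_comp; congr act; congr act; apply/esym.
exact: (hu j' k' d d' jk' hj hk).
Qed.

Lemma kan_fill (X : cset) n (i : 'I_n) e (u : 'I_n -> bool -> X n.-1) :
  is_kan X -> matching i e u ->
  exists x : X n, forall j d, (j, d) <> (i, e) -> face j d x = u j d.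
Proof.
move=> hX hu.
have ch m (x : open_box i e m) : {t : 'I_n * bool * boxhom m n.-1 |
    t.1 <> (i, e) /\ proj1_sig x = bcomp (bface t.1.1 t.1.2) t.2}.
  by apply: cid; case: x => x [j [d [y h]]] /=; exists (j, d, y).
pose fn m (x : open_box i e m) : X m :=
  let t := proj1_sig (ch m x) in act t.2 (u t.1.1 t.1.2).
have fnE m (x : open_box i e m) j d y : (j, d) <> (i, e) ->
    proj1_sig x = bcomp (bface j d) y -> fn m x = act y (u j d).
  move=> hj hx; rewrite /fn; case: (ch m x) => -[[j' d'] y'] /= [hj' hx'].
  by apply: hu; rewrite // -hx -hx'.
have fn_nat m p (f : boxhom m p) (x : open_box i e p) :
    fn m (act f x) = act f (fn p x).
  case: (ch p x) => -[[j d] y] /= [hj hx].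
  rewrite (fnE _ _ _ _ y hj hx) -act_comp; apply: fnE => //=.
  by rewrite hx bcompA.
have [g hg] := hX _ _ _ (CMap fn_nat).
exists (g n (bid n)) => j d hj; rewrite /face -cmapP /=.
have hb : in_open_box i e (bface j d).
  by exists j, d, (bid _); split=> //; rewrite bcomp1.
have := hg _ (exist _ _ hb); rewrite /= bcomp_id => ->.
by rewrite (fnE _ _ j d (bid _)) ?act_id //= bcomp1.
Qed.

Lemma kan_intro (X : cset) :
  (forall n (i : 'I_n) e (u : 'I_n -> bool -> X n.-1), matching i e u ->
    exists x : X n, forall j d, (j, d) <> (i, e) -> face j d x = u j d) ->
  is_kan X.
Proof.
move=> hX n i e f.
have hb j d : (j, d) <> (i, e) -> in_open_box i e (bface j d).
  by move=> h; exists j, d, (bid _); split=> //; rewrite bcomp1.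
have [x0|noX] := pselect (exists x : X n.-1, True); last first.
  exfalso; apply: noX.
  have h : (i, ~~ e) <> (i, e) by case=> h'; move: f; case: (e) h'.
  by exists (f _ (exist _ _ (hb _ _ h))).
case: x0 => x0 _.
pose u j d : X n.-1 :=
  if pselect ((j, d) <> (i, e)) is left h then f _ (exist _ _ (hb _ _ h)) else x0.
have uE j d (h : (j, d) <> (i, e)) : u j d = f _ (exist _ _ (hb _ _ h)).
  by rewrite /u; case: pselect => // h'; rewrite (Prop_irrelevance h h').
have hu : matching i e u.
  move=> j d k d' m a b hj hk hab; rewrite !uE -!cmapP; congr (f _ _).
  exact: eq_exist.
have [x hx] := hX _ _ _ _ hu.
have gP m p (a : boxhom m p) (y : yoneda n p) : act (act a y) x = act a (act y x).
  by rewrite -act_comp.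
exists (CMap gP) => m [y hy] /=.
have [j [d [z [hj ey]]]] := hy.
rewrite {1}ey act_comp -/(face _ _ _) (hx _ _ hj) uE -cmapP; congr (f _ _).
exact: eq_exist.
Qed.

Record pkan : Type := PKan {
  pkan_cset :> cset ; pkanP : is_kan pkan_cset ; base : pkan_cset 0 }.
Arguments pkanP : clear implicits.

Section Loop.
Variable X : pkan.

Definition loop_cells n : Type :=
  {y : X n.+1 | forall e, @face X n.+1 ord0 e y = tdegen n (base X)}.

Lemma bshift_face0 m n (f : boxhom m n) e :
  bcomp (bshift f) (@bface m.+1 ord0 e) = bcomp (@bface n.+1 ord0 e) f.
Proof.
apply: boxhom_eq => x /=; rewrite /bshift_fun ins_same.
by rewrite (@del_ins _ m.+1).
Qed.

Lemma loop_subproof m n (f : boxhom m n) (y : X n.+1) :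
  (forall e, @face X n.+1 ord0 e y = tdegen n (base X)) ->
  forall e, @face X m.+1 ord0 e (act (bshift f) y) = tdegen m (base X).
Proof.
move=> hy e; rewrite /face -act_comp bshift_face0 act_comp.
by move: (hy e); rewrite /face => ->; exact: act_tdegen.
Qed.

Definition loop_act m n (f : boxhom m n) (y : loop_cells n) : loop_cells m :=
  exist _ _ (loop_subproof f (proj2_sig y)).

Lemma loop_act_id n (y : loop_cells n) : loop_act (bid n) y = y.
Proof. by case: y => y hy; apply: eq_exist; rewrite /= bshift_id act_id. Qed.

Lemma loop_act_comp m n p (f : boxhom n p) (g : boxhom m n) (y : loop_cells p) :
  loop_act (bcomp f g) y = loop_act g (loop_act f y).
Proof. by apply: eq_exist; rewrite /= bshift_comp act_comp. Qed.

Definition loop_cset : cset := CSet loop_act_id loop_act_comp.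

Lemma loop_base_subproof e :
  @face X 1 ord0 e (tdegen 1 (base X)) = tdegen 0 (base X).
Proof. exact: act_tdegen. Qed.

Definition loop_base : loop_cset 0 := exist _ _ loop_base_subproof.

Lemma loop_tdegen n : proj1_sig (tdegen n loop_base) = tdegen n.+1 (base X).
Proof. exact: act_tdegen. Qed.

Lemma loop_face n (i : 'I_n.+1) e (y : loop_cset n.+1) :
  proj1_sig (face i e y) = @face X n.+2 (lift ord0 i) e (proj1_sig y).
Proof. by rewrite /= bshift_face. Qed.

Lemma loop_kan : is_kan loop_cset.
Proof.
apply: kan_intro => -[[]//|p] i e u hu.
pose U (j : 'I_p.+2) d : X p.+1 :=
  if unlift ord0 j is Some k then proj1_sig (u k d) else tdegen p.+1 (base X).
have Ul k d : U (lift ord0 k) d = proj1_sig (u k d) by rewrite /U liftK.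
have U0 d : U ord0 d = tdegen p.+1 (base X) by rewrite /U unlift_none.
have hU : @matching X p.+2 (lift ord0 i) e U.
  apply: matching_faces => j k d d' jk hj hk; rewrite Ul.
  case: (unliftP ord0 j) => [j'|] ej.
    rewrite {}ej in jk hj *; case: p i u hu U Ul U0 j k j' jk hj hk => [_ _ _ _ _ _ _ _ []//|p].
    move=> i u hu U Ul U0 _ k j' jk hj hk.
    have e1 : widen_ord (leqnSn p.+2) (lift ord0 j') = lift ord0 (widen_ord (leqnSn p.+1) j').
      exact: val_inj.
    rewrite e1 Ul in hj *; case: (unliftP ord0 k) => [k'|] ek; rewrite {}ek in jk hk *; last by [].
    rewrite -!loop_face; congr proj1_sig; apply: hu.
    - by move=> h; apply: hk; case: h => -> ->.
    - by move=> h; apply: hj; case: h => -> ->.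
    - by apply: bface_comm; move: jk; rewrite /= /bump; lia.
  have -> : widen_ord (leqnSn p.+1) j = ord0 by rewrite ej; apply: val_inj.
  rewrite ej U0 (proj2_sig (u k d')); exact/esym/act_tdegen.
have [x hx] := kan_fill (pkanP X) hU.
have xP d : @face X p.+2 ord0 d x = tdegen p.+1 (base X) by rewrite hx // U0.
exists (exist _ x xP) => j d hj; apply: sig_eq.
rewrite /= bshift_face; move: (hx (lift ord0 j) d); rewrite Ul /face => -> //.
by move=> [h1 h2]; apply: hj; congr pair => //; apply: val_inj; move: h1; rewrite /= /bump; lia.
Qed.

Definition loop : pkan := PKan loop_kan loop_base.
End Loop.

(* Relative maps from the n-cube and its boundary to (X, base X). *)
Record rcube (n : nat) (X : pkan) : Type := RCube {
  rcube_cell :> X n ;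
  rcubeP : forall (i : 'I_n) e, face i e rcube_cell = tdegen n.-1 (base X) }.

Definition homotopic (n : nat) (X : pkan) (u v : rcube n X) : Prop :=
  exists h : X n.+1,
    [/\ face ord_max false h = u, face ord_max true h = v &
        forall i e, i != ord_max -> face i e h = tdegen n (base X)].

Definition hpi (n : nat) (X : pkan) : Type := quot (@homotopic n X).

Lemma rcube_eq n X (u v : rcube n X) : u = v :> X n -> u = v.
Proof.
case: u v => [u hu] [v hv] /= e; rewrite e in hu *.
by rewrite (Prop_irrelevance hu hv).
Qed.

Lemma rcube_const_subproof n (X : pkan) (i : 'I_n) e :
  face i e (tdegen n (base X)) = tdegen n.-1 (base X).
Proof. exact: act_tdegen. Qed.

Definition rcube_const n (X : pkan) : rcube n X :=
  RCube (@rcube_const_subproof n X).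

Lemma face_degen_same (X : cset) n (i : 'I_n) e (x : X n.-1) : face i e (degen i x) = x.
Proof.
rewrite /face /degen -act_comp -[RHS]act_id; congr act.
by apply: boxhom_eq => y; rewrite /= del_ins.
Qed.

Lemma ord1E (i : 'I_1) : i = ord0. Proof. by case: i => [[]//] ?; apply: val_inj. Qed.

Local Notation o20 := (@ord0 1).
Local Notation o21 := (@ord_max 1).

Lemma ord2E (i : 'I_2) : i = o20 \/ i = o21.
Proof. by case: i => [[|[|//]]] h; [left|right]; apply: val_inj. Qed.

Lemma face_degen01 (X : cset) e (x : X 1) :
  @face X 2 o21 e (@degen X 2 o20 x) = @degen X 1 ord0 (@face X 1 ord0 e x).
Proof.
rewrite /face /degen -!act_comp; congr act.
apply: boxhom_eq => y; apply: funext => j /=; rewrite /del (ord1E j).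
have -> : lift o20 ord0 = o21 by apply: val_inj.
by rewrite !ins_same.
Qed.

Lemma face_degen10 (X : cset) e (x : X 1) :
  @face X 2 o20 e (@degen X 2 o21 x) = @degen X 1 ord0 (@face X 1 ord0 e x).
Proof.
rewrite /face /degen -!act_comp; congr act.
apply: boxhom_eq => y; apply: funext => j /=; rewrite /del (ord1E j).
have -> : lift o21 ord0 = o20 by apply: val_inj.
by rewrite !ins_same.
Qed.

(* [s2 l r b t] are the faces (1,0), (1,1), (2,0), (2,1) of a square. *)
Definition s2 (T : Type) (l r b t : T) (i : 'I_2) (e : bool) : T :=
  if i == o20 then (if e then r else l) else (if e then t else b).

Lemma fill2 (X : pkan) (i : 'I_2) e (l r b t : X 1) :
  (forall d d', (o20, d) <> (i, e) -> (o21, d') <> (i, e) ->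
    @face X 1 ord0 d (if d' then t else b) = @face X 1 ord0 d' (if d then r else l)) ->
  exists x : X 2, forall j d, (j, d) <> (i, e) -> @face X 2 j d x = s2 l r b t j d.
Proof.
move=> h; apply: (kan_fill (pkanP X)).
apply: (@matching_faces X 0) => j k d d' _; rewrite (ord1E j) (ord1E k).
have -> : widen_ord (leqnSn 1) ord0 = o20 by apply: val_inj.
have -> : lift o20 ord0 = o21 by apply: val_inj.
move=> h1 h2; exact: h.
Qed.

Definition o30 : 'I_3 := @Ordinal 3 0 isT.
Definition o31 : 'I_3 := @Ordinal 3 1 isT.
Definition o32 : 'I_3 := @Ordinal 3 2 isT.

Definition s3 (T : Type) (a b c : bool -> T) (i : 'I_3) (e : bool) : T :=
  if i == o30 then a e else if i == o31 then b e else c e.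

Lemma fill3 (X : pkan) (i : 'I_3) e (a b c : bool -> X 2) :
  (forall d d', (o30, d) <> (i, e) -> (o31, d') <> (i, e) ->
    @face X 2 o20 d (b d') = @face X 2 o20 d' (a d)) ->
  (forall d d', (o30, d) <> (i, e) -> (o32, d') <> (i, e) ->
    @face X 2 o20 d (c d') = @face X 2 o21 d' (a d)) ->
  (forall d d', (o31, d) <> (i, e) -> (o32, d') <> (i, e) ->
    @face X 2 o21 d (c d') = @face X 2 o21 d' (b d)) ->
  exists x : X 3, forall j d, (j, d) <> (i, e) -> @face X 3 j d x = s3 a b c j d.
Proof.
move=> h1 h2 h3; apply: (kan_fill (pkanP X)).
have e0 : widen_ord (leqnSn 2) o20 = o30 by apply: val_inj.
have e1 : widen_ord (leqnSn 2) o21 = o31 by apply: val_inj.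
have e2 : lift (@ord0 2) o20 = o31 by apply: val_inj.
have e3 : lift (@ord0 2) o21 = o32 by apply: val_inj.
apply: (@matching_faces X 1) => j k d d'.
have [->|->] := ord2E j; have [->|->] := ord2E k; rewrite ?e0 ?e1 ?e2 ?e3 //= => _ hj hk.
- exact: h1.
- exact: h2.
- exact: h3.
Qed.

Lemma face_face2 (X : cset) (x : X 3) d e :
  [/\ @face X 2 o20 d (@face X 3 o31 e x) = @face X 2 o20 e (@face X 3 o30 d x),
      @face X 2 o20 d (@face X 3 o32 e x) = @face X 2 o21 e (@face X 3 o30 d x) &
      @face X 2 o21 d (@face X 3 o32 e x) = @face X 2 o21 e (@face X 3 o31 d x)].
Proof.
have e0 : widen_ord (leqnSn 2) o20 = o30 by apply: val_inj.
have e1 : widen_ord (leqnSn 2) o21 = o31 by apply: val_inj.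
have e2 : lift (@ord0 2) o20 = o31 by apply: val_inj.
have e3 : lift (@ord0 2) o21 = o32 by apply: val_inj.
have h (j k : 'I_2) : (j <= k)%N -> @face X 2 j d (@face X 3 (lift ord0 k) e x)
    = @face X 2 k e (@face X 3 (widen_ord (leqnSn 2) j) d x).
  by move=> jk; rewrite /face -!act_comp; congr act; apply: bface_comm.
by split; [have := h o20 o20 | have := h o20 o21 | have := h o21 o21];
  rewrite ?e0 ?e1 ?e2 ?e3; apply.
Qed.

Lemma face_face1 (X : cset) (x : X 2) d e :
  @face X 1 ord0 d (@face X 2 o21 e x) = @face X 1 ord0 e (@face X 2 o20 d x).
Proof.
rewrite /face -!act_comp; congr act.
have := @bface_comm 0 ord0 ord0 d e isT.
have -> : widen_ord (leqnSn 1) ord0 = o20 by apply: val_inj.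
by have -> : lift o20 ord0 = o21 by apply: val_inj.
Qed.

Definition rloop_cell n (X : pkan) (u : rcube n.+1 X) : loop X n :=
  exist _ (rcube_cell u) (rcubeP u ord0).

Lemma rloop_subproof n (X : pkan) (u : rcube n.+1 X) (i : 'I_n) e :
  face i e (rloop_cell u) = tdegen n.-1 (base (loop X)).
Proof.
apply: sig_eq; rewrite loop_tdegen; case: n u i => [u []//|m] u i.
by rewrite loop_face; exact: (rcubeP u).
Qed.

Definition rloop n (X : pkan) (u : rcube n.+1 X) : rcube n (loop X) := RCube (rloop_subproof u).

Lemma rdeloop_subproof n (X : pkan) (u : rcube n (loop X)) (i : 'I_n.+1) e :
  face i e (proj1_sig (rcube_cell u)) = tdegen n (base X).
Proof.
case: (unliftP ord0 i) => [i'|] ->{i}; last exact: (proj2_sig (rcube_cell u)).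
case: n u i' => [? []//|m] u i' /=; rewrite -loop_face (rcubeP u) /=.
exact: act_tdegen.
Qed.

Definition rdeloop n (X : pkan) (u : rcube n (loop X)) : rcube n.+1 X := RCube (rdeloop_subproof u).

Lemma rloopK n (X : pkan) (u : rcube n.+1 X) : rdeloop (rloop u) = u. Proof. exact: rcube_eq. Qed.
Lemma rdeloopK n (X : pkan) (u : rcube n (loop X)) : rloop (rdeloop u) = u.
Proof. by apply: rcube_eq; apply: sig_eq. Qed.

Lemma rloop_homotopic n (X : pkan) (u v : rcube n.+1 X) : homotopic (rloop u) (rloop v) <-> homotopic u v.
Proof.
have emax : lift (@ord0 n.+1) (@ord_max n) = @ord_max n.+1 by apply: val_inj.
split=> -[h [h0 h1 hh]].
  exists (proj1_sig h); split.
  - by rewrite -emax -loop_face h0.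
  - by rewrite -emax -loop_face h1.
  - move=> i e ni; case: (unliftP ord0 i) => [i'|] ei; last first.
      by rewrite ei; exact: (proj2_sig h).
    rewrite ei -loop_face hh; first exact: act_tdegen.
    by apply/eqP => hi; case/eqP: ni; rewrite ei hi emax.
have hP e : @face X n.+2 ord0 e h = tdegen n.+1 (base X) by rewrite hh.
exists (exist _ h hP); split.
- by apply: sig_eq; rewrite loop_face emax.
- by apply: sig_eq; rewrite loop_face emax.
- move=> i e ni; apply: sig_eq; rewrite loop_face loop_tdegen; apply: hh.
  by rewrite -emax (inj_eq (@lift_inj _ _)).
Qed.

Lemma homotopic_equiv n X : equiv (@homotopic n X).
Proof.
elim: n X => [|n IH] X; last first.
  have [Rr Rs Rt] := IH (loop X); split=> [x|x y|x y z]; rewrite -!rloop_homotopic //.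
  - exact: Rs.
  - exact: Rt.
have emax : (@ord_max 0) = ord0 by apply: val_inj.
apply: equiv_eucl => [u|u u' u'' [h [h0 h1 _]] [h' [h0' h1' _]]].
  exists (@degen X 1 ord0 (rcube_cell u)); rewrite emax; split.
  - exact: (@face_degen_same X 1).
  - exact: (@face_degen_same X 1).
  - by move=> i e; rewrite (ord1E i) eqxx.
rewrite emax in h0 h1 h0' h1'.
have [|x hx] := @fill2 X o21 true h (@degen X 1 ord0 (rcube_cell u'')) h' h.
  move=> [] [] // _ _.
  - by rewrite (@face_degen_same X 1).
  - by rewrite h0 h0'.
exists (@face X 2 o21 true x); rewrite emax; split.
- by rewrite face_face1 hx // /s2 /= h1.
- by rewrite face_face1 hx // /s2 /= (@face_degen_same X 1).
- by move=> i e; rewrite (ord1E i) eqxx.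
Qed.

Definition hpi_base n X : hpi n X := class _ (rcube_const n X).

Section LoopIso.
Variables (n : nat) (X : pkan).

Definition hpi_loop (a : hpi n.+1 X) : hpi n (loop X) := class _ (rloop (repr a)).
Definition hpi_deloop (a : hpi n (loop X)) : hpi n.+1 X := class _ (rdeloop (repr a)).

Lemma hpi_loopE u : hpi_loop (class _ u) = class _ (rloop u).
Proof.
apply/classE; first exact: homotopic_equiv.
by apply/rloop_homotopic; apply: repr_class; exact: homotopic_equiv.
Qed.

Lemma hpi_deloopE u : hpi_deloop (class _ u) = class _ (rdeloop u).
Proof.
apply/classE; first exact: homotopic_equiv.
by apply/rloop_homotopic; rewrite !rdeloopK; apply: repr_class; exact: homotopic_equiv.
Qed.

Lemma hpi_loopK : cancel hpi_loop hpi_deloop.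
Proof. by move=> a; elim/quotP: a => u; rewrite hpi_loopE hpi_deloopE rloopK. Qed.
Lemma hpi_deloopK : cancel hpi_deloop hpi_loop.
Proof. by move=> a; elim/quotP: a => u; rewrite hpi_deloopE hpi_loopE rdeloopK. Qed.

Lemma hpi_loop_base : hpi_loop (hpi_base n.+1 X) = hpi_base n (loop X).
Proof.
rewrite hpi_loopE; congr class; apply: rcube_eq; apply: sig_eq.
by rewrite loop_tdegen.
Qed.
End LoopIso.

(* [prod_rel u v w] : some 2-cube exhibits [w] as the product of [u] and [v]. *)
Definition prod_rel (X : pkan) (u v w : rcube 1 X) : Prop :=
  exists h : X 2,
    [/\ @face X 2 ord0 false h = u,
        @face X 2 ord0 true h = @degen X 1 ord0 (@face X 1 ord0 true v),
        @face X 2 ord_max true h = v &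
        @face X 2 ord_max false h = w].

Section Pi1.
Variable X : pkan.
Local Notation c := (tdegen 1 (base X)).

Definition sq (l r b t : X 1) : Prop :=
  exists x : X 2, forall j d, @face X 2 j d x = s2 l r b t j d.

Lemma sqP (l r b t : X 1) (x : X 2) :
  @face X 2 o20 false x = l -> @face X 2 o20 true x = r ->
  @face X 2 o21 false x = b -> @face X 2 o21 true x = t -> sq l r b t.
Proof. by move=> h1 h2 h3 h4; exists x => j []; have [->|->] := ord2E j. Qed.

Lemma rcube_end (u : rcube 1 X) i e : @face X 1 i e u = tdegen 0 (base X).
Proof. exact: (rcubeP u). Qed.

Lemma prod_relE (u v w : rcube 1 X) : prod_rel u v w <-> sq u c w v.
Proof.
rewrite /prod_rel rcube_end; have -> : @degen X 1 ord0 (tdegen 0 (base X)) = c.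
  exact: act_tdegen.
split=> [[h [h1 h2 h3 h4]]|[x hx]]; first exact: sqP h1 h2 h4 h3.
by exists x; rewrite !hx.
Qed.

Lemma homotopicE (u v : rcube 1 X) : homotopic u v <-> sq c c u v.
Proof.
split=> [[h [h1 h2 h3]]|[x hx]]; first by apply: (sqP _ _ h1 h2); exact: h3.
exists x; split; rewrite ?hx // => i e.
by have [->|->] := ord2E i; rewrite ?eqxx // hx; case: e.
Qed.

Lemma sq_const : sq c c c c.
Proof. by apply: (@sqP _ _ _ _ (tdegen 2 (base X))); exact: act_tdegen. Qed.

Lemma sq_degen0 (u : rcube 1 X) : sq u u c c.
Proof.
apply: (@sqP _ _ _ _ (@degen X 2 o20 u)); first exact: (@face_degen_same X 2).
- exact: (@face_degen_same X 2).
- by rewrite face_degen01 rcube_end; exact: act_tdegen.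
- by rewrite face_degen01 rcube_end; exact: act_tdegen.
Qed.

Lemma sq_degen1 (u : rcube 1 X) : sq c c u u.
Proof.
apply: (@sqP _ _ _ _ (@degen X 2 o21 u)).
- by rewrite face_degen10 rcube_end; exact: act_tdegen.
- by rewrite face_degen10 rcube_end; exact: act_tdegen.
- exact: (@face_degen_same X 2).
- exact: (@face_degen_same X 2).
Qed.

Lemma sq_conn (u : rcube 1 X) : sq u c u c.
Proof.
have w0 : widen_ord (leqnSn 1) ord0 = o20 by apply: val_inj.
have w1 : lift ord0 ord0 = o21 by apply: val_inj.
have l0 : o21 = lift o20 ord0 by apply: val_inj.
have l1 : o20 = lift o21 ord0 by apply: val_inj.
have hc e : act (bterm 1) (@face X 1 ord0 e u) = c by rewrite rcube_end; exact: act_tdegen.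
apply: (@sqP _ _ _ _ (act (@bconn 1 ord0 false) (rcube_cell u))); rewrite /face -act_comp.
- rewrite -[RHS]act_id; congr act; apply: boxhom_eq => y; apply: funext => j /=.
  by rewrite /conn (ord1E j) w0 w1 eqxx ins_same l0 ins_lift.
- rewrite -(hc true) /face -act_comp; congr act; apply: boxhom_eq => y; apply: funext => j /=.
  by rewrite /conn (ord1E j) w0 w1 eqxx !ins_same.
- rewrite -[RHS]act_id; congr act; apply: boxhom_eq => y; apply: funext => j /=.
  by rewrite /conn (ord1E j) w0 w1 eqxx ins_same l1 ins_lift orbF.
- rewrite -(hc true) /face -act_comp; congr act; apply: boxhom_eq => y; apply: funext => j /=.
  by rewrite /conn (ord1E j) w0 w1 eqxx !ins_same orbT.
Qed.

Lemma sq_fill (i : 'I_2) e (l r b t : rcube 1 X) :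
  exists z : rcube 1 X,
    sq (if (i, e) == (o20, false) then z else l)
       (if (i, e) == (o20, true) then z else r)
       (if (i, e) == (o21, false) then z else b)
       (if (i, e) == (o21, true) then z else t).
Proof.
have [|x hx] := @fill2 X i e l r b t.
  by move=> d d' _ _; case: d d' => -[]; rewrite !rcube_end.
have hz (j : 'I_1) d : @face X 1 j d (@face X 2 i e x) = tdegen 0 (base X).
  rewrite (ord1E j); have [ei|ei] := ord2E i; rewrite ei.
    have nj : (o21, d) <> (i, e) by rewrite ei.
    have := hx _ _ nj; rewrite /s2 -face_face1 => ->.
    by rewrite -(rcube_end (if d then t else b) ord0 e); case: (d).
  have nj : (o20, d) <> (i, e) by rewrite ei.
  have := hx _ _ nj; rewrite /s2 face_face1 => ->.
  by rewrite -(rcube_end (if d then r else l) ord0 e); case: (d).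
pose z : rcube 1 X := @RCube 1 X (@face X 2 i e x) hz.
have h j d : @face X 2 j d x = if (i, e) == (j, d) then rcube_cell z else s2 (rcube_cell l) r b t j d.
  by case: eqP => [[<- <-]|ne] //; apply: hx => h; apply: ne.
by exists z; apply: (@sqP _ _ _ _ x); rewrite h /s2; case: eqP.
Qed.

Lemma cube3 (E1 E2 E3 : bool -> bool -> X 1) (i : 'I_3) e
  (Q := fun (j : 'I_3) d => s3
    (fun d => sq (E3 d false) (E3 d true) (E2 d false) (E2 d true))
    (fun d => sq (E3 false d) (E3 true d) (E1 d false) (E1 d true))
    (fun d => sq (E2 false d) (E2 true d) (E1 false d) (E1 true d)) j d) :
  (forall j d, (j, d) <> (i, e) -> Q j d) -> Q i e.
Proof.
move=> hQ.
pose S (j : 'I_3) d (y : X 2) := s3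
    (fun d => forall k d', @face X 2 k d' y = s2 (E3 d false) (E3 d true) (E2 d false) (E2 d true) k d')
    (fun d => forall k d', @face X 2 k d' y = s2 (E3 false d) (E3 true d) (E1 d false) (E1 d true) k d')
    (fun d => forall k d', @face X 2 k d' y = s2 (E2 false d) (E2 true d) (E1 false d) (E1 true d) k d') j d.
have QS j d : Q j d <-> exists y, S j d y.
  by rewrite /Q /S /s3; case: ifP => // _; case: ifP.
have hy (p : 'I_3 * bool) : exists y : X 2, p <> (i, e) -> S p.1 p.2 y.
  case: p => j d; have [h|h] := pselect ((j, d) = (i, e)).
    by exists (tdegen 2 (base X)).
  by have /QS [y hy] := hQ _ _ h; exists y.
have [Y hY] := choice hy.
have Ya d : (o30, d) <> (i, e) -> forall k d', @face X 2 k d' (Y (o30, d)) = s2 (E3 d false) (E3 d true) (E2 d false) (E2 d true) k d'.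
  exact: (hY (o30, d)).
have Yb d : (o31, d) <> (i, e) -> forall k d', @face X 2 k d' (Y (o31, d)) = s2 (E3 false d) (E3 true d) (E1 d false) (E1 d true) k d'.
  exact: (hY (o31, d)).
have Yc d : (o32, d) <> (i, e) -> forall k d', @face X 2 k d' (Y (o32, d)) = s2 (E2 false d) (E2 true d) (E1 false d) (E1 true d) k d'.
  exact: (hY (o32, d)).
have [|||x hx] := @fill3 X i e (fun d => Y (o30, d)) (fun d => Y (o31, d)) (fun d => Y (o32, d)).
- by move=> d d' h1 h2; rewrite Ya // Yb // /s2 /=; case: (d); case: (d').
- by move=> d d' h1 h2; rewrite Ya // Yc // /s2 /=; case: (d); case: (d').
- by move=> d d' h1 h2; rewrite Yb // Yc // /s2 /=; case: (d); case: (d').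
have xa d : (o30, d) <> (i, e) -> forall k d', @face X 2 k d' (@face X 3 o30 d x) = s2 (E3 d false) (E3 d true) (E2 d false) (E2 d true) k d'.
  by move=> h; rewrite hx //; exact: Ya.
have xb d : (o31, d) <> (i, e) -> forall k d', @face X 2 k d' (@face X 3 o31 d x) = s2 (E3 false d) (E3 true d) (E1 d false) (E1 d true) k d'.
  by move=> h; rewrite hx //; exact: Yb.
have xc d : (o32, d) <> (i, e) -> forall k d', @face X 2 k d' (@face X 3 o32 d x) = s2 (E2 false d) (E2 true d) (E1 false d) (E1 true d) k d'.
  by move=> h; rewrite hx //; exact: Yc.
apply/QS; exists (@face X 3 i e x).
have [ei|[ei|ei]] : i = o30 \/ i = o31 \/ i = o32.
  by case: (i) => [[|[|[|//]]]] ?; [left|right;left|right;right]; apply: val_inj.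
- rewrite ei /S /s3 /= => k d'; have [f1 f2 f3] := face_face2 x e d'.
  have [->|->] := ord2E k; rewrite -?f1 -?f2 ?xb ?xc ?ei // /s2 /=;
    by case: (d'); case: (e).
- rewrite ei /S /s3 /= => k d'; have [f1 f2 f3] := face_face2 x d' e; have [g1 g2 g3] := face_face2 x e d'.
  have [->|->] := ord2E k; rewrite ?f1 -?g3 ?xa ?xc ?ei // /s2 /=;
    by case: (d'); case: (e).
- rewrite ei /S /s3 /= => k d'; have [f1 f2 f3] := face_face2 x d' e.
  have [->|->] := ord2E k; rewrite ?f2 ?f3 ?xa ?xb ?ei // /s2 /=;
    by case: (d'); case: (e).
Qed.

Local Ltac box_sides tac :=
  case=> [[|[|[|//]]] ?] [] /=; let ne := fresh in intro ne;
  solve [assumption | exact: sq_const | exact: sq_conn | exact: sq_degen1 | tac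
        | exfalso; apply ne; congr pair; apply: val_inj; reflexivity].

Lemma sq_homotopic (u u' v v' w w' : rcube 1 X) :
  sq u c w v -> sq u' c w' v' -> homotopic u u' -> homotopic v v' -> homotopic w w'.
Proof.
rewrite !homotopicE => h h' hu hv.
pose E1 (x2 x3 : bool) : X 1 :=
  if x2 then (if x3 then v' else v) else (if x3 then w' else w).
pose E2 (x1 x3 : bool) : X 1 := if x1 then c else (if x3 then u' else u).
have := @cube3 E1 E2 (fun _ _ => c) o31 false; rewrite /s3 /=; apply.
box_sides idtac.
Qed.

Lemma sq_swap (u v p : rcube 1 X) : sq u c p v -> sq p v u c.
Proof.
move=> h.
pose E1 (x2 x3 : bool) : X 1 := if x3 then c else if x2 then v else p.
pose E2 (x1 x3 : bool) : X 1 := if x3 then c else if x1 then c else u.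
pose E3 (x1 x2 : bool) : X 1 := if x1 then c else if x2 then v else p.
have := @cube3 E1 E2 E3 o30 false; rewrite /s3 /=; apply.
box_sides idtac.
Qed.

Lemma sq_assoc (u v w p q r : rcube 1 X) :
  sq u c p v -> sq p c q w -> sq v c r w -> sq u c q r.
Proof.
move=> h1 h2 h3.
pose E1 (x2 x3 : bool) : X 1 := if x3 then w else if x2 then r else q.
pose E2 (x1 x3 : bool) : X 1 := if x1 then c else if x3 then c else u.
pose E3 (x1 x2 : bool) : X 1 := if x1 then c else if x2 then v else p.
have := @cube3 E1 E2 E3 o32 false; rewrite /s3 /=; apply.
box_sides ltac:(exact: sq_swap).
Qed.

Lemma prod_rel_ex (u v : rcube 1 X) : exists w, prod_rel u v w.
Proof.
have [w hw] := sq_fill o21 false u (rcube_const 1 X) (rcube_const 1 X) v.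
by exists w; apply/prod_relE.
Qed.
End Pi1.

Definition hmul1 (X : pkan) (a b : hpi 1 X) : hpi 1 X :=
  class _ (proj1_sig (cid (prod_rel_ex (repr a) (repr b)))).

Lemma hmul1E (X : pkan) (u v w : rcube 1 X) :
  prod_rel u v w -> hmul1 (class _ u) (class _ v) = class _ w.
Proof.
move=> h; rewrite /hmul1; case: cid => w' /= h'; apply/classE.
  exact: homotopic_equiv.
move/prod_relE: h => h; move/prod_relE: h' => h'.
by apply: (sq_homotopic h' h); apply: repr_class; exact: homotopic_equiv.
Qed.

(* The product on pi_(n+1): on pi_1 it is given by fillers, and it is transported
   from pi_n(Omega X) = ... = pi_1(Omega^n X) to pi_(n+1)(X). *)
Fixpoint hmul (n : nat) : forall X : pkan, hpi n.+1 X -> hpi n.+1 X -> hpi n.+1 X :=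
  match n with
  | 0 => hmul1
  | m.+1 => fun X a b => hpi_deloop (hmul (hpi_loop a) (hpi_loop b))
  end.

Lemma hmul1A X : associative (@hmul1 X).
Proof.
move=> a b d; elim/quotP: a => u; elim/quotP: b => v; elim/quotP: d => w.
have [p hp] := prod_rel_ex u v; have [q hq] := prod_rel_ex p w.
have [r hr] := prod_rel_ex v w.
rewrite (hmul1E hp) (hmul1E hq) (hmul1E hr); apply: hmul1E; apply/prod_relE.
by apply: (@sq_assoc _ u v w p q r); apply/prod_relE.
Qed.

Lemma hmul1_1l X : left_id (hpi_base 1 X) (@hmul1 X).
Proof.
by move=> a; elim/quotP: a => u; apply: hmul1E; apply/prod_relE; exact: sq_degen1.
Qed.

Lemma hmul1_1r X : right_id (hpi_base 1 X) (@hmul1 X).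
Proof.
by move=> a; elim/quotP: a => u; apply: hmul1E; apply/prod_relE; exact: sq_conn.
Qed.

Lemma hmul1_inv X (a : hpi 1 X) :
  exists b, hmul1 b a = hpi_base 1 X /\ hmul1 a b = hpi_base 1 X.
Proof.
have R : exists b, hmul1 a b = hpi_base 1 X.
  elim/quotP: a => u.
  have [w hw] := sq_fill o21 true u (rcube_const 1 X) (rcube_const 1 X) (rcube_const 1 X).
  by exists (class _ w); apply: hmul1E; apply/prod_relE.
have L : exists b, hmul1 b a = hpi_base 1 X.
  elim/quotP: a {R} => u.
  have [w hw] := sq_fill o20 false u (rcube_const 1 X) (rcube_const 1 X) u.
  by exists (class _ w); apply: hmul1E; apply/prod_relE.
case: R => b hb; case: L => b' hb'; exists b; split=> //.
by rewrite -[b]hmul1_1l -hb' -[hmul1 (hmul1 b' a) b]hmul1A hb hmul1_1r.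
Qed.

Lemma hmulA n X : associative (@hmul n X).
Proof.
elim: n X => [|n IH] X; first exact: hmul1A.
by move=> a b d /=; rewrite !hpi_deloopK IH.
Qed.

Lemma hmul_1l n X : left_id (hpi_base n.+1 X) (@hmul n X).
Proof.
elim: n X => [|n IH] X; first exact: hmul1_1l.
by move=> a /=; rewrite hpi_loop_base IH hpi_loopK.
Qed.

Lemma hmul_1r n X : right_id (hpi_base n.+1 X) (@hmul n X).
Proof.
elim: n X => [|n IH] X; first exact: hmul1_1r.
by move=> a /=; rewrite hpi_loop_base IH hpi_loopK.
Qed.

Lemma hmul_inv n X (a : hpi n.+1 X) :
  exists b, hmul b a = hpi_base n.+1 X /\ hmul a b = hpi_base n.+1 X.
Proof.
elim: n X a => [|n IH] X a; first exact: hmul1_inv.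
have [b [h1 h2]] := IH _ (hpi_loop a); exists (hpi_deloop b) => /=.
by rewrite hpi_deloopK h1 h2 -hpi_loop_base hpi_loopK.
Qed.

Definition hinv n X (a : hpi n.+1 X) : hpi n.+1 X := proj1_sig (cid (hmul_inv a)).

Lemma hmul_Vl n X : left_inverse (hpi_base n.+1 X) (@hinv n X) (@hmul n X).
Proof. by move=> a; rewrite /hinv; case: cid => b []. Qed.
Lemma hmul_Vr n X : right_inverse (hpi_base n.+1 X) (@hinv n X) (@hmul n X).
Proof. by move=> a; rewrite /hinv; case: cid => b []. Qed.

HB.instance Definition _ n X := gen_eqMixin (hpi n X).
HB.instance Definition _ n X := gen_choiceMixin (hpi n X).
HB.instance Definition _ n X :=
  isGroup.Build (hpi n.+1 X) (@hmulA n X) (@hmul_1l n X) (@hmul_1r n X)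
    (@hmul_Vl n X) (@hmul_Vr n X).

Local Open Scope ring_scope.

Definition stable (T : Type) n (M : nat) (f : ('I_n -> int) -> T) : Prop :=
  forall (i : 'I_n) (v : 'I_n -> int),
    (M%:Z < v i -> f v = f (upd i M%:Z v)) /\
    (v i < - M%:Z -> f v = f (upd i (- M%:Z) v)).

Record ncube (G : graph) (n : nat) : Type := NCube {
  ncube_map :> gmap (grid n) G ;
  ncubeP : exists M, stable M ncube_map }.

Lemma ncube_eq G n (f g : ncube G n) : f =1 g -> f = g.
Proof.
case: f g => [f hf] [g hg] /= e; have {}e : f = g by exact: gmap_eq.
by rewrite e in hf *; rewrite (Prop_irrelevance hf hg).
Qed.

Definition clamp (M : nat) (x : int) : int := Num.max (- M%:Z) (Num.min x M%:Z).

Lemma clamp_bnd M x : - M%:Z <= clamp M x <= M%:Z.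
Proof. by rewrite /clamp; lia. Qed.

Lemma clamp_id M x : - M%:Z <= x <= M%:Z -> clamp M x = x.
Proof. by rewrite /clamp; lia. Qed.

Lemma stable_clamp T n M (f : ('I_n -> int) -> T) v :
  stable M f -> f (fun j => clamp M (v j)) = f v.
Proof.
move=> hf.
suff h (s : seq 'I_n) : f (fun j => if j \in s then clamp M (v j) else v j) = f v.
  rewrite -(h (enum 'I_n)); congr f; apply: funext => j.
  by rewrite mem_enum.
elim: s => [|i s IH]; first by [].
rewrite -IH; set w := fun j => if j \in s then _ else _.
have -> : (fun j => if j \in i :: s then clamp M (v j) else v j) = upd i (clamp M (w i)) w.
  apply: funext => j; rewrite /upd inE /w; case: eqP => [->|] //=.
  by case: ifP => // _; rewrite (clamp_id (clamp_bnd _ _)).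
have [h1 h2] := hf i w.
have [lt1|le1] := ltP M%:Z (w i).
  by rewrite (h1 lt1); congr f; congr upd; rewrite /clamp; lia.
have [lt2|le2] := ltP (w i) (- M%:Z).
  by rewrite (h2 lt2); congr f; congr upd; rewrite /clamp; lia.
rewrite clamp_id ?le1 ?le2 //; congr f; apply: funext => j; rewrite /upd.
by case: eqP => [->|].
Qed.

Lemma clamp_stable T n M (f : ('I_n -> int) -> T) :
  (forall v, f (fun j => clamp M (v j)) = f v) -> stable M f.
Proof.
move=> hf i v; split=> h; rewrite -[LHS]hf -[RHS]hf; congr f; apply: funext => j;
  by rewrite /upd; case: eqP => [->|] //; rewrite /clamp; lia.
Qed.

Lemma stable_le T n M N (f : ('I_n -> int) -> T) :
  (M <= N)%N -> stable M f -> stable N f.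
Proof.
move=> MN hf; apply: clamp_stable => v.
rewrite -(stable_clamp _ hf) -[RHS](stable_clamp _ hf); congr f.
by apply: funext => j; rewrite /clamp; lia.
Qed.

(* The extension of [phi : [1]^m -> [1]^n] to a map from Z^m to
   {-M, ..., M}^n, reading 0 and 1 as -M and M: threshold by threshold, the
   j-th coordinate of [ext M phi v] exceeds [t] iff [phi] maps the point
   [(t < v_k)_k] to a point with j-th coordinate 1.  On the generators it gives
   the expected formulas, see [nact_face], [nact_degen] and [nact_conn]. *)
Definition ext m n (M : nat) (phi : cube m -> cube n) (v : 'I_m -> int) :
  'I_n -> int :=
  fun j => (\sum_(s < M.*2) (phi (fun k => (s%:Z - M%:Z < v k)%R) j : nat))%N%:Z - M%:Z.

Definition realizes m n (M : nat) (phi : cube m -> cube n)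
    (Phi : ('I_m -> int) -> 'I_n -> int) : Prop :=
  forall v j (t : int), - M%:Z <= t < M%:Z ->
    (t < Phi v j) = phi (fun k => t < v k) j.

Lemma sum_thr (N : nat) (y : int) :
  (\sum_(s < N) ((s%:Z < y)%R : nat))%N%:Z = Num.max 0 (Num.min y N%:Z).
Proof.
elim: N => [|N IH]; first by rewrite big_ord0; lia.
by rewrite big_ord_recr /= PoszD IH; case: ltP => /=; lia.
Qed.

Lemma extE m n M (phi : cube m -> cube n) Phi :
  realizes M phi Phi -> forall v, ext M phi v = fun j => clamp M (Phi v j).
Proof.
move=> h v; apply: funext => j; rewrite /ext.
have -> : \sum_(s < M.*2) (phi (fun k => (s%:Z - M%:Z < v k)%R) j : nat) =
          \sum_(s < M.*2) ((s%:Z < Phi v j + M%:Z)%R : nat).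
  apply: eq_bigr => s _; rewrite -h; last by have := ltn_ord s; lia.
  by congr (nat_of_bool _); lia.
by rewrite sum_thr /clamp; lia.
Qed.

Lemma realizes_comp m n p M (phi : cube n -> cube p) (psi : cube m -> cube n) F H :
  realizes M phi F -> realizes M psi H -> realizes M (phi \o psi) (F \o H).
Proof.
move=> hF hH v j t ht /=; rewrite hF //; congr (phi _ j); apply: funext => k.
exact: hH.
Qed.

Lemma realizes_face n M (i : 'I_n) e :
  realizes M (ins i e) (ins i (if e then M%:Z else - M%:Z)).
Proof.
move=> v j t ht; rewrite /ins; case: unlift => // .
by case: e; lia.
Qed.

Lemma realizes_degen n M (i : 'I_n) : realizes M (@del _ _ i) (@del _ _ i).
Proof. by []. Qed.

Lemma realizes_conn n M (i : 'I_n) e :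
  realizes M (conn (if e then andb else orb) i)
    (conn (if e then Num.min : int -> int -> int else Num.max) i).
Proof.
move=> v j t ht; rewrite /conn; case: eqP => // _.
by case: e; [rewrite lt_min | rewrite lt_max].
Qed.

Definition is_gmap (G H : graph) (f : G -> H) : Prop :=
  forall v w, adj v w -> adj (f v) (f w).

Lemma gmap_ins n (i : 'I_n) (a : int) : @is_gmap (grid n.-1) (grid n) (ins i a).
Proof.
move=> v w; apply: adj_powP => [->//|k hk h].
apply: (@adj_pow Iinf n _ _ (lift i k)); first by rewrite !ins_lift.
move=> j nj; rewrite /ins; case: unliftP => // l ej; apply: h.
by move: nj; rewrite ej; apply: contraNneq => ->.
Qed.

Lemma gmap_del n (i : 'I_n) : @is_gmap (grid n) (grid n.-1) (@del _ _ i).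
Proof.
move=> v w; apply: adj_powP => [->//|k hk h].
case: (unliftP i k) => [k'|] ek; last first.
  by left; apply: funext => j; apply: h; rewrite ek eq_sym neq_lift.
apply: (@adj_pow Iinf n.-1 _ _ k'); first by rewrite /del -ek.
by move=> j nj; apply: h; rewrite ek (inj_eq (@lift_inj _ _)).
Qed.

Lemma gmap_conn n (i : 'I_n) e : @is_gmap (grid n.+1) (grid n)
    (conn (if e then Num.min : int -> int -> int else Num.max) i).
Proof.
move=> v w; apply: adj_powP => [->//|k /adj_Iinf hk h].
have hv (l : 'I_n.+1) : l = k \/ v l = w l.
  by have [->|/h] := eqVneq l k; [left|right].
have wd j : j != i -> lift (lift ord0 i) j != widen_ord (leqnSn n) i /\
    lift (lift ord0 i) j != lift ord0 i.
  move=> /eqP nj; split; apply/eqP => /(congr1 val) /=; rewrite /bump => h'; apply: nj;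
  by apply: val_inj => /=; lia.
have wl : widen_ord (leqnSn n) i != lift ord0 i.
  by apply/eqP => /(congr1 val) /=; rewrite /bump; lia.
have [ki|nki] := boolP ((k == widen_ord (leqnSn n) i) || (k == lift ord0 i)).
  apply: (@adj_pow Iinf n _ _ i).
    apply/adj_Iinf; rewrite /conn eqxx.
    case/orP: ki => /eqP ki; rewrite ki in hk h hv.
      rewrite -(h (lift ord0 i)); last by rewrite eq_sym.
      by case: e; lia.
    rewrite -(h (widen_ord _ i)) //.
    by case: e; lia.
  move=> j nj; rewrite /conn (negbTE nj); apply: h.
  have [w1 w2] := wd _ nj.
  by apply/eqP => ej; case/orP: ki => /eqP ki; [case/eqP: w1|case/eqP: w2]; rewrite ej ki.
move: nki; rewrite negb_or => /andP [n1 n2].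
have [k' ek] : exists k', k = lift (lift ord0 i) k'.
  case: (unliftP (lift ord0 i) k) => [k'|] e'; first by exists k'.
  by rewrite e' eqxx in n2.
have nk' : k' != i.
  apply/eqP => e'; case/eqP: n1; rewrite ek e'; apply: val_inj.
  by rewrite /= /bump; lia.
apply: (@adj_pow Iinf n _ _ k').
  by apply/adj_Iinf; rewrite /conn (negbTE nk') -ek.
move=> j nj; rewrite /conn; case: eqP => [_|/eqP ni].
  by rewrite !h // eq_sym.
by apply: h; rewrite ek (inj_eq (@lift_inj _ _)).
Qed.

Lemma box_realizes m n (M : nat) (phi : cube m -> cube n) : box_gen phi ->
  exists Phi, realizes M phi Phi /\ @is_gmap (grid m) (grid n) Phi.
Proof.
elim=> {m n phi} [n|m n p f g _ [F [h1 h2]] _ [H [h3 h4]]|n i e|n i|n i e].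
- by exists id; split.
- exists (F \o H); split; first exact: realizes_comp.
  by move=> v w vw; apply: h2; apply: h4.
- by eexists; split; [exact: realizes_face|exact: gmap_ins].
- by eexists; split; [exact: realizes_degen|exact: gmap_del].
- by eexists; split; [exact: realizes_conn|exact: gmap_conn].
Qed.

Lemma ext_bnd m n M (phi : cube m -> cube n) v j :
  - M%:Z <= ext M phi v j <= M%:Z.
Proof.
rewrite /ext; set S := (\sum_(s < _) _)%N.
have : (S <= M.*2)%N.
  rewrite -[leqRHS]card_ord -sum1_card; apply: leq_sum => s _.
  by case: (phi _ _).
by lia.
Qed.

Lemma ext_realizes m n M (phi : boxhom m n) : realizes M phi (ext M phi).
Proof.
move=> v j t ht; have [F [hF _]] := box_realizes M (boxfunP phi).
by rewrite (extE hF) -hF // /clamp; lia.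
Qed.

Lemma thr_inj (M : nat) (x y : int) : - M%:Z <= x <= M%:Z -> - M%:Z <= y <= M%:Z ->
  (forall t : int, - M%:Z <= t < M%:Z -> (t < x) = (t < y)) -> x = y.
Proof.
move=> hx hy h; have [lt|lt|//] := ltgtP x y.
  by have := h x; lia.
by have := h y; lia.
Qed.

Lemma ext_clamp m n M (phi : cube m -> cube n) v :
  ext M phi (fun k => clamp M (v k)) = ext M phi v.
Proof.
apply: funext => j; rewrite /ext; congr (_%:Z - _); apply: eq_bigr => s _.
congr (nat_of_bool (phi _ j)); apply: funext => k; rewrite /clamp.
by have := ltn_ord s; lia.
Qed.

Lemma ext_comp m n p M (phi : boxhom n p) (psi : boxhom m n) v :
  ext M (bcomp phi psi) v = ext M phi (ext M psi v).
Proof.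
apply: funext => j; apply: (@thr_inj M); rewrite ?ext_bnd // => t ht.
rewrite !ext_realizes //=; congr (boxfun phi _ j); apply: funext => k.
by rewrite ext_realizes.
Qed.

Lemma ext_id n M (v : 'I_n -> int) : ext M (bid n) v = fun j => clamp M (v j).
Proof. by rewrite (@extE _ _ M (bid n) id). Qed.

Lemma ext_le m n M N (phi : boxhom m n) v : (M <= N)%N ->
  (fun j => clamp M (ext N phi v j)) = ext M phi v.
Proof.
move=> MN; apply: funext => j; apply: (@thr_inj M); rewrite ?ext_bnd ?clamp_bnd //.
move=> t ht; rewrite ext_realizes // -(@ext_realizes _ _ N phi) /clamp; lia.
Qed.

Section NerveAction.
Variables (G : graph) (m n : nat) (phi : boxhom m n) (f : ncube G n).

Definition nact_fun : grid m -> G :=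
  fun v => f (ext (proj1_sig (cid (ncubeP f))) phi v).

Lemma nact_funE M : stable M f -> forall v, nact_fun v = f (ext M phi v).
Proof.
move=> hM v; rewrite /nact_fun; case: cid => N /= hN.
have [le|le] := leqP M N.
  by rewrite -(stable_clamp _ hM) ext_le.
by rewrite -[RHS](stable_clamp _ hN) ext_le // ltnW.
Qed.

Lemma nact_realizes M Phi : stable M f -> realizes M phi Phi ->
  forall v, nact_fun v = f (Phi v).
Proof. by move=> hM hP v; rewrite (nact_funE hM) (extE hP) stable_clamp. Qed.

Lemma nact_gmap : is_gmap nact_fun.
Proof.
case: (ncubeP f) => M hM v w vw.
have [Phi [h1 h2]] := box_realizes M (boxfunP phi).
by rewrite !(nact_realizes hM h1); apply: gmapP; apply: h2.
Qed.

Lemma nact_stable M : stable M f -> stable M nact_fun.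
Proof.
by move=> hM; apply: clamp_stable => v; rewrite !(nact_funE hM) ext_clamp.
Qed.

Definition nact : ncube G m :=
  @NCube G m (GMap nact_gmap)
    (let: ex_intro M hM := ncubeP f in ex_intro _ M (nact_stable hM)).
End NerveAction.

Lemma nact_id G n (f : ncube G n) : nact (bid n) f = f.
Proof.
apply: ncube_eq => v; case: (ncubeP f) => M hM.
exact: (@nact_realizes _ _ _ (bid n) f M id).
Qed.

Lemma nact_comp G m n p (phi : boxhom n p) (psi : boxhom m n) (f : ncube G p) :
  nact (bcomp phi psi) f = nact psi (nact phi f).
Proof.
apply: ncube_eq => v; case: (ncubeP f) => M hM /=.
rewrite (nact_funE _ hM) ext_comp -(nact_funE phi hM).
by rewrite (@nact_funE _ _ _ psi (nact phi f) M (nact_stable phi hM)).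
Qed.

Definition nerve_cset (G : graph) : cset :=
  @CSet (ncube G) (@nact G) (@nact_id G) (@nact_comp G).

Lemma nact_face G n (i : 'I_n) e (f : nerve_cset G n) M : stable M (ncube_map f) ->
  forall v, (face i e f : ncube G _) v = f (ins i (if e then M%:Z else - M%:Z) v).
Proof. by move=> hM v; apply: nact_realizes hM _ v; exact: realizes_face. Qed.

Lemma nact_degen G n (i : 'I_n) (f : nerve_cset G n.-1) v :
  (degen i f : ncube G _) v = f (del i v).
Proof.
by case: (ncubeP f) => M hM; apply: nact_realizes hM _ v; exact: realizes_degen.
Qed.

Lemma nact_conn G n (i : 'I_n) e (f : nerve_cset G n) v :
  (act (bconn i e) f : ncube G _) v =
  f (conn (if e then Num.min : int -> int -> int else Num.max) i v).
Proof.
by case: (ncubeP f) => M hM; apply: nact_realizes hM _ v; exact: realizes_conn.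
Qed.

Lemma nact_tdegen G n (f : nerve_cset G 0) v w :
  (tdegen n f : ncube G n) v = (f : ncube G 0) w.
Proof.
case: (ncubeP f) => M hM; rewrite /tdegen /= (nact_funE _ hM); congr (gmap_fun _ _).
by apply: funext => -[].
Qed.

Lemma ins_del_ne T m (j k : 'I_m) (a : T) x : k != j -> ins j a (del j x) k = x k.
Proof.
case: (unliftP j k) => [l ->|->]; last by rewrite eqxx.
by rewrite ins_lift.
Qed.

Section NerveKan.
Variables (G : graph) (n : nat) (i : 'I_n) (e : bool).
Variables (u : 'I_n -> bool -> ncube G n.-1).
Hypothesis hu : @matching (nerve_cset G) n i e u.

Let sgn (d : bool) (a : int) : int := if d then a else - a.

Lemma common_stable : exists M, (0 < M)%N /\ forall j d, stable M (u j d).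
Proof.
have h (p : 'I_n * bool) : exists M, stable M (u p.1 p.2) by exact: ncubeP.
have [N hN] := choice h.
exists (\max_p N p).+1; split=> // j d; apply: stable_le (hN (j, d)).
by apply: leqW; exact: (leq_bigmax (j, d)).
Qed.

Section WithBound.
Variables (M : nat) (M0 : (0 < M)%N) (hM : forall j d, stable M (u j d)).

Let onface (p : 'I_n -> int) (q : 'I_n * bool) : Prop :=
  q <> (i, e) /\ p q.1 = sgn q.2 M.

Let g0 : G := u i (~~ e) (fun _ => 0).

Definition box_val (p : 'I_n -> int) : G :=
  if pselect (exists q, onface p q) is left h then
    let q := proj1_sig (cid h) in u q.1 q.2 (del q.1 p) else g0.

Lemma box_val_wd p q q' : onface p q -> onface p q' ->
  u q.1 q.2 (del q.1 p) = u q'.1 q'.2 (del q'.1 p).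
Proof.
case: q q' => [j d] [k d'] [nj hj] [nk hk] /=; rewrite /= in hj hk.
have [jk|jk] := eqVneq j k.
  have -> : d = d'; last by rewrite jk.
  by move: hj hk; rewrite jk => ->; rewrite /sgn; case: (d); case: (d') => //; lia.
pose proj l b : boxhom n n := bcomp (bface l b) (bdegen l).
pose R l b : ('I_n -> int) -> 'I_n -> int := fun x => ins l (sgn b M) (del l x).
have hR l b : realizes M (proj l b) (R l b).
  apply: (realizes_comp (F := ins l (sgn b M)) (H := @del _ _ l)).
    exact: realizes_face.
  exact: realizes_degen.
pose a := bcomp (proj j d) (proj k d').
have hRp l b : p l = sgn b M -> R l b p = p by move=> h; rewrite /R -h; exact: ins_del.
have ha : realizes M a (R j d \o R k d') by apply: realizes_comp.
have e1 : bcomp (bface j d) (bcomp (bdegen j) a) = bcomp (bface k d') (bcomp (bdegen k) a).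
  apply: boxhom_eq => x /=; rewrite del_ins.
  set y := ins j d _; have <- : y k = d'; last by rewrite ins_del.
  by rewrite /y ins_del_ne 1?eq_sym // ins_same.
have := congr1 (fun f : ncube G n => f p) (hu nj nk e1).
have hd l : realizes M (bcomp (bdegen l) a) (@del _ _ l \o (R j d \o R k d')).
  by apply: realizes_comp; first exact: realizes_degen.
rewrite /= (nact_realizes (hM j d) (hd j)) (nact_realizes (hM k d') (hd k)) /=.
by rewrite !hRp.
Qed.

Lemma box_valE p q : onface p q -> box_val p = u q.1 q.2 (del q.1 p).
Proof.
rewrite /box_val => h; case: pselect => [ex|nex]; last by case: nex; exists q.
by apply: box_val_wd => //; case: cid.
Qed.

Lemma box_val_adj (p q : grid n) :
  (exists s, onface p s) -> (exists s, onface q s) ->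
  adj p q -> adj (box_val p) (box_val q).
Proof.
move=> [[j d] hp] [[k d'] hq]; apply: adj_powP => [->//|l /adj_Iinf hl h].
suff [s [h1 h2]] : exists s, onface p s /\ onface q s.
  rewrite (box_valE h1) (box_valE h2); apply: gmapP; apply: gmap_del.
  by apply: (@adj_pow Iinf n _ _ l) => //; apply/adj_Iinf.
have [lj|lj] := eqVneq j l; last first.
  by exists (j, d); split=> //; case: hp => n1 h1; split=> //=; rewrite -h.
have [lk|lk] := eqVneq k l; last first.
  by exists (k, d'); split=> //; case: hq => n1 h1; split=> //=; rewrite h.
exists (j, d); split=> //; case: hp hq => [n1 h1] [n2 h2]; split=> //=.
rewrite /= lj lk in h1 h2 *; rewrite h2; move: hl; rewrite h1 h2.
by rewrite /sgn; case: (d); case: (d') => //; lia.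
Qed.

(* The point [v] is sent to the point of the box reached by clamping its
   coordinates, the height in direction [i] being moreover bounded by the
   distance of [v] to the column over the inner cube. *)
Definition dist (v : 'I_n -> int) : nat := \max_(j | j != i) (`|v j|%N - M)%N.

Definition height (v : 'I_n -> int) : int :=
  sgn e (Num.min (clamp M (sgn e (v i))) ((dist v)%:Z - M%:Z)).

Definition retr (v : 'I_n -> int) : 'I_n -> int :=
  fun j => if j == i then height v else clamp M (v j).

Lemma retr_onface v : exists q, onface (retr v) q.
Proof.
have [d0|] := posnP (dist v).
  exists (i, ~~ e); split; first by case; case: (e).
  rewrite /retr eqxx /height d0 /sgn /clamp; case: (e) => /=; lia.
move=> hd; have [j nj hj] : exists2 j, j != i & (0 < `|v j|%N - M)%N.
  apply: contrapT => h; move: hd; rewrite /dist big1 // => j nj.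
  by apply/eqP; rewrite -leqn0 leqNgt; apply/negP => h'; apply: h; exists j.
exists (j, 0 < v j); split; first by case=> /eqP; rewrite (negbTE nj).
by rewrite /retr (negbTE nj) /= /sgn /clamp; case: ltP; lia.
Qed.

Lemma dist_adj (v w : 'I_n -> int) k : k != i ->
  `|v k - w k| <= 1 -> (forall j, j != k -> v j = w j) ->
  (dist v <= (dist w).+1)%N.
Proof.
move=> nk hk h; rewrite /dist (bigD1 k) //= [in leqRHS](bigD1 k) //=.
have -> : \max_(j | (j != i) && (j != k)) (`|v j| - M)%N =
          \max_(j | (j != i) && (j != k)) (`|w j| - M)%N.
  by apply: eq_bigr => j /andP [_ /h ->].
by move: (\max_(j | _) _)%N => S; lia.
Qed.

Lemma retr_gmap : @is_gmap (grid n) (grid n) retr.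
Proof.
move=> v w; apply: adj_powP => [->//|k /adj_Iinf hk h].
have [ki|ki] := eqVneq k i.
  rewrite {}ki in hk h; apply: (@adj_pow Iinf n _ _ i).
    apply/adj_Iinf; rewrite /retr eqxx /height.
    have -> : dist v = dist w by apply: eq_bigr => j /h ->.
    by rewrite /sgn /clamp; case: (e); lia.
  by move=> j nj; rewrite /retr (negbTE nj) h.
have hi : v i = w i by apply: h; rewrite eq_sym.
have [hb|hb] := boolP ((`|v k|%N <= M)%N && (`|w k|%N <= M)%N).
  apply: (@adj_pow Iinf n _ _ k).
    by apply/adj_Iinf; rewrite /retr (negbTE ki) /clamp; lia.
  move=> j nj; rewrite /retr; case: eqP => [_|_]; last by rewrite h.
  rewrite /height hi; suff -> : dist v = dist w by [].
  apply: eq_bigr => l nl; have [->|nlk] := eqVneq l k; last by rewrite h.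
  by lia.
apply: (@adj_pow Iinf n _ _ i).
  apply/adj_Iinf; rewrite /retr eqxx /height hi.
  have h1 := dist_adj ki hk h.
  have h2 : (dist w <= (dist v).+1)%N.
    by apply: (@dist_adj _ _ k) => //; [rewrite distrC|move=> j /h].
  by rewrite /sgn /clamp; case: (e); lia.
move=> j nj; rewrite /retr (negbTE nj).
have [->|njk] := eqVneq j k; last by rewrite h.
by rewrite /clamp; lia.
Qed.

Let N := (3 * M)%N.

Lemma dist_clamp v :
  minn (dist (fun j => clamp N (v j))) (2 * M) = minn (dist v) (2 * M).
Proof.
have h s : (s < 2 * M)%N -> (dist (fun j => clamp N (v j)) <= s)%N = (dist v <= s)%N.
  move=> hs; apply/bigmax_leqP/bigmax_leqP => h j nj; move: (h j nj);
  by rewrite /clamp /N; lia.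
have [l1|l1] := ltnP (dist v) (2 * M).
  have l2 := h _ l1; rewrite leqnn in l2.
  have l3 := h _ (leq_ltn_trans l2 l1); rewrite leqnn in l3.
  by lia.
have [l2|l2] := ltnP (dist (fun j => clamp N (v j))) (2 * M); last by lia.
by have := h _ l2; rewrite leqnn; lia.
Qed.

Lemma retr_stable v : retr (fun j => clamp N (v j)) = retr v.
Proof.
apply: funext => j; rewrite /retr; case: eqP => _; last by rewrite /clamp /N; lia.
have := dist_clamp v; rewrite /height; move: (dist _) (dist v) => a b.
by rewrite /sgn /clamp /N; case: (e); lia.
Qed.

Lemma filler_gmap : @is_gmap (grid n) G (fun v => box_val (retr v)).
Proof.
move=> v w vw; apply: box_val_adj; [exact: retr_onface|exact: retr_onface|].
exact: retr_gmap.
Qed.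

Lemma filler_stable : stable N (fun v => box_val (retr v)).
Proof. by apply: clamp_stable => v /=; rewrite retr_stable. Qed.

Definition filler : ncube G n :=
  @NCube G n (GMap filler_gmap) (ex_intro _ N filler_stable).

Lemma filler_face j d : (j, d) <> (i, e) -> @face (nerve_cset G) n j d filler = u j d.
Proof.
move=> hj; apply: ncube_eq => v.
rewrite (@nact_face _ _ _ _ filler N filler_stable) /=; set w := ins j _ v.
have wj : w j = sgn d N by rewrite /w ins_same.
have h : retr w = ins j (sgn d M) (fun k => clamp M (v k)).
  apply: (@liftP _ _ j); [rewrite ins_same|move=> k; rewrite ins_lift]; rewrite /retr.
    case: eqP => [ji|nji]; last by rewrite wj /sgn /clamp /N; case: (d); lia.
    have ed : d = ~~ e.
      by case: (d) (e) hj => [] [] // hj'; case: hj'; rewrite ji.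
    by rewrite /height -ji wj ed /sgn /clamp /N; case: (e) => /=; lia.
  case: eqP => [ki|_]; last by rewrite /w ins_lift.
  have nj : j != i by rewrite -ki neq_lift.
  have hd : (2 * M <= dist w)%N.
    apply: leq_trans (@leq_bigmax_cond _ _ (fun j => (`|w j|%N - M)%N) j nj).
    by rewrite wj /sgn /N; case: (d); lia.
  have -> : v k = w i by rewrite -ki /w ins_lift.
  by rewrite /height /sgn /clamp; case: (e); lia.
rewrite h (@box_valE _ (j, d)) /=; last by split=> //=; rewrite ins_same.
by rewrite del_ins; apply: stable_clamp.
Qed.
End WithBound.

Lemma nerve_fill : exists x : ncube G n, forall j d, (j, d) <> (i, e) ->
  @face (nerve_cset G) n j d x = u j d.
Proof.
have [M [M0 hM]] := common_stable.
by exists (filler M0 hM) => j d; exact: filler_face.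
Qed.
End NerveKan.

Lemma nerve_kan (G : graph) : is_kan (nerve_cset G).
Proof. by apply: kan_intro => n i e u; exact: nerve_fill. Qed.

Definition nerve_vertex (G : graph) (v : G) : ncube G 0 :=
  @NCube G 0 (gmap_const (grid 0) v)
    (ex_intro _ 0%N (fun _ _ => conj (fun _ => erefl) (fun _ => erefl))).

Definition nerve (G : pgraph) : pkan :=
  @PKan (nerve_cset G) (@nerve_kan G) (nerve_vertex (pt G)).

Definition far n (M : nat) (v : 'I_n -> int) : Prop := exists i, M%:Z <= `|v i|.

Definition const_far n (G : pgraph) (M : nat) (f : ('I_n -> int) -> G) : Prop :=
  forall v, far M v -> f v = pt G.

Record amap (n : nat) (G : pgraph) : Type := AMap {
  amap_map :> gmap (grid n) G ;
  amapP : exists M, const_far M amap_map }.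

Definition ahomotopic (n : nat) (G : pgraph) (f g : amap n G) : Prop :=
  exists (m : nat) (h : gmap (prod_graph (grid n) (I_ m)) G),
    [/\ forall v, h (v, ord0) = f v, forall v, h (v, ord_max) = g v &
        exists K, forall v t, far K v -> h (v, t) = pt G].

Definition A_ (n : nat) (G : pgraph) : Type := quot (@ahomotopic n G).

Definition amap_const (n : nat) (G : pgraph) : amap n G :=
  @AMap n G (gmap_const (grid n) (pt G)) (ex_intro _ 0%N (fun _ _ => erefl)).

Definition A_base (n : nat) (G : pgraph) : A_ n G := class _ (amap_const n G).

Lemma amap_eq n G (f g : amap n G) : f =1 g -> f = g.
Proof.
case: f g => [f hf] [g hg] /= e; have {}e : f = g by exact: gmap_eq.
by rewrite e in hf *; rewrite (Prop_irrelevance hf hg).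
Qed.

Lemma far_le n M N (v : 'I_n -> int) : (M <= N)%N -> far N v -> far M v.
Proof. by move=> h [i hi]; exists i; lia. Qed.

Lemma const_far_le n (G : pgraph) M N (f : ('I_n -> int) -> G) : (M <= N)%N ->
  const_far M f -> const_far N f.
Proof. by move=> h hf v /(far_le h); exact: hf. Qed.

Definition step n G (f g : amap n G) : Prop := forall v, adj (f v) (g v).

Lemma ahomotopicP n G (f g : amap n G) :
  ahomotopic f g <-> exists (m : nat) (s : nat -> amap n G),
    [/\ s 0%N = f, s m = g & forall k, (k < m)%N -> step (s k) (s k.+1)].
Proof.
split=> [[m [h [h0 h1 [K hK]]]]|[m [s [h0 h1 hs]]]].
  have hg k : is_gmap (fun v : grid n => h (v, inord k)).
    by move=> v w vw; apply: gmapP; apply/adj_prod; right.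
  pose s k : amap n G := @AMap n G (GMap (hg k))
    (ex_intro _ K (fun v hv => hK v (inord k) hv)).
  exists m, s; split.
  - apply: amap_eq => v /=; rewrite -h0; congr (h (v, _)).
    by apply: val_inj; rewrite /= inordK.
  - apply: amap_eq => v /=; rewrite -h1; congr (h (v, _)).
    by apply: val_inj; rewrite /= inordK.
  - move=> k km v /=; apply: gmapP; apply/adj_prod; left; split=> //=.
    by right; left; rewrite !inordK // ltnS // ltnW.
have hg : @is_gmap (prod_graph (grid n) (I_ m)) G (fun p => s (val p.2) p.1).
  move=> [v a] [w b] /adj_prod /= [[-> []]|[-> vw]]; last exact: gmapP.
    by move->.
  case=> ab.
    by rewrite -ab; apply: hs; have := ltn_ord b; rewrite -ab; lia.
  rewrite -ab; apply: adj_sym; apply: hs.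
  by have := ltn_ord a; rewrite -ab; lia.
exists m, (GMap hg); split=> [v|v|] /=; rewrite ?h0 ?h1 //.
have [K hK] := choice (fun k => amapP (s k)).
exists (\max_(k < m.+1) K k)%N => v t hv /=; apply: (hK t).
by apply: far_le hv; exact: (leq_bigmax t).
Qed.

Lemma ahomotopic_equiv n G : equiv (@ahomotopic n G).
Proof.
split=> [f|f g|f g h].
- by apply/ahomotopicP; exists 0%N, (fun _ => f); split.
- move=> /ahomotopicP [m [s [h0 h1 hs]]]; apply/ahomotopicP.
  exists m, (fun k => s (m - k)%N); split; rewrite ?subn0 ?subnn // => k km v.
  by rewrite -(subnSK km); apply: adj_sym; apply: hs; lia.
- move=> /ahomotopicP [m [s [h0 h1 hs]]] /ahomotopicP [p [t [k0 k1 kt]]].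
  apply/ahomotopicP; exists (m + p)%N.
  exists (fun k => if (k <= m)%N then s k else t (k - m)%N); split=> //=.
  + case: leqP => [hp|hp]; last by rewrite addKn.
    have p0 : p = 0%N by lia.
    by move: k1; rewrite p0 addn0 h1 k0.
  + move=> k hk; have [lt|ge] := ltnP k m; first by rewrite (ltnW lt); exact: hs.
    case: leqP => [le|gt].
      have -> : k = m by lia.
      by rewrite subSnn h1 -k0; apply: kt; lia.
    by rewrite subSn //; apply: kt; lia.
Qed.

Lemma ahomotopic_step n G (f g : amap n G) : step f g -> ahomotopic f g.
Proof.
move=> h; apply/ahomotopicP; exists 1%N, (fun k => if k is 0 then f else g).
by split=> // -[].
Qed.

Lemma ahomotopic_seq n G (s : nat -> amap n G) m :
  (forall k, step (s k) (s k.+1)) -> ahomotopic (s 0%N) (s m).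
Proof. by move=> h; apply/ahomotopicP; exists m, s; split. Qed.

Lemma ahomotopic_ind n G T (F : amap n G -> T) :
  (forall f g, step f g -> F f = F g) -> forall f g, ahomotopic f g -> F f = F g.
Proof.
move=> hF f g /ahomotopicP [m [s [<- <- hs]]].
elim: m hs => [//|m IH] hs; rewrite IH; first by apply: hF; exact: hs.
by move=> k km; apply: hs; exact: ltnW.
Qed.

Lemma A_E n G (f g : amap n G) :
  class (@ahomotopic n G) f = class _ g <-> ahomotopic f g.
Proof. exact: (classE _ _ (ahomotopic_equiv n G)). Qed.

Definition concat n (G : pgraph) (i : 'I_n) (M M' : nat)
    (f g : ('I_n -> int) -> G) : ('I_n -> int) -> G :=
  fun v => if v i <= M%:Z then f v else g (upd i (v i - M%:Z - M'%:Z) v).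

Definition superpose n (G : pgraph) (c : 'I_n -> int) (f g : ('I_n -> int) -> G) :
  ('I_n -> int) -> G :=
  fun v => if `[< f v = pt G >] then g (fun j => v j - c j) else f v.

Definition axis n (i : 'I_n) (s : nat) : 'I_n -> int :=
  fun j => if j == i then s%:Z else 0.

Section Superpose.
Variables (n : nat) (G : pgraph).
Implicit Types (f g h : amap n G) (c d : 'I_n -> int) (i j : 'I_n).

Definition apart c f g : Prop :=
  exists M M', [/\ const_far M f, const_far M' g & far (M + M')%N c].

Lemma apart_near c f g v w : apart c f g -> adj (v : grid n) w ->
  f v <> pt G -> g (fun j => w j - c j) = pt G.
Proof.
move=> [M [M' [hf hg [i hi]]]] vw fv; apply: hg; exists i.
have : `|v i| < M%:Z.
  by rewrite ltNge; apply/negP => h; apply: fv; apply: hf; exists i.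
have : `|v i - w i| <= 1.
  apply: adj_powP vw => [->|k /adj_Iinf hk h]; first by rewrite subrr.
  by have [->|/h ->] := eqVneq i k; rewrite ?subrr.
by lia.
Qed.

Lemma superpose_out c f g v : apart c f g -> f v <> pt G ->
  superpose c f g v = f v /\ g (fun j => v j - c j) = pt G.
Proof.
move=> h fv; rewrite /superpose asboolF //; split=> //.
exact: apart_near h (adj_refl (v : grid n)) fv.
Qed.

Lemma superpose_in c f g v : f v = pt G ->
  superpose c f g v = g (fun j => v j - c j).
Proof. by move=> fv; rewrite /superpose asboolT. Qed.

Lemma adj_shift c (v w : grid n) : adj v w ->
  adj ((fun j => v j - c j) : grid n) (fun j => w j - c j).
Proof.
apply: adj_powP => [->//|k /adj_Iinf hk h].
apply: (@adj_pow Iinf n _ _ k); first by apply/adj_Iinf; lia.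
by move=> j /h ->.
Qed.

Lemma superpose_gmap c f g : apart c f g -> @is_gmap (grid n) G (superpose c f g).
Proof.
move=> ha v w vw.
have [fv|fv] := pselect (f v = pt G); have [fw|fw] := pselect (f w = pt G).
- by rewrite !superpose_in //; apply: gmapP; apply: adj_shift.
- have [-> _] := superpose_out ha fw; rewrite superpose_in //.
  by rewrite (apart_near ha (adj_sym vw) fw) -fv; exact: gmapP.
- have [-> _] := superpose_out ha fv; rewrite (superpose_in _ _ fw).
  by rewrite (apart_near ha vw fv) -fw; exact: gmapP.
- have [-> _] := superpose_out ha fv; have [-> _] := superpose_out ha fw.
  exact: gmapP.
Qed.

Lemma superpose_const M M' K c f g : const_far M f -> const_far M' g ->
  (forall j, `|c j| <= K%:Z) -> const_far (M + M' + K)%N (superpose c f g).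
Proof.
move=> hf hg hc v [j hj]; have hcj := hc j.
rewrite superpose_in; first by apply: hg; exists j; lia.
by apply: hf; exists j; lia.
Qed.

Lemma superpose_far c f g : exists K, const_far K (superpose c f g).
Proof.
have [[M hf] [M' hg]] := (amapP f, amapP g).
exists (M + M' + \max_j `|c j|)%N; apply: superpose_const => // j.
by have := @leq_bigmax _ (fun j => `|c j|%N) j; lia.
Qed.

Definition sup c f g (h : apart c f g) : amap n G :=
  @AMap n G (GMap (superpose_gmap h)) (superpose_far c f g).

Lemma sup_step c d f g (hc : apart c f g) (hd : apart d f g) :
  adj (c : grid n) d -> step (sup hc) (sup hd).
Proof.
move=> cd v /=; have [fv|fv] := pselect (f v = pt G).
  rewrite !superpose_in //; apply: gmapP; move: cd.
  apply: adj_powP => [->//|k /adj_Iinf hk h].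
  apply: (@adj_pow Iinf n _ _ k); first by apply/adj_Iinf; lia.
  by move=> j /h ->.
by have [-> _] := superpose_out hc fv; have [-> _] := superpose_out hd fv.
Qed.

Lemma sup_path (c : nat -> 'I_n -> int) f g (hc : forall k, apart (c k) f g) m :
  (forall k, adj (c k : grid n) (c k.+1)) -> ahomotopic (sup (hc 0%N)) (sup (hc m)).
Proof.
move=> h; apply: (@ahomotopic_seq n G (fun k => sup (hc k))) => k.
exact: sup_step.
Qed.

Lemma apart_coord M M' c f g i : const_far M f -> const_far M' g ->
  (M + M')%N%:Z <= `|c i| -> apart c f g.
Proof. by move=> hf hg hc; exists M, M'; split=> //; exists i. Qed.

Lemma adj_coord (c d : grid n) i : `|c i - d i| <= 1 ->
  (forall j, j != i -> c j = d j) -> adj c d.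
Proof. by move=> h1 h2; apply: (@adj_pow Iinf n _ _ i) => //; apply/adj_Iinf. Qed.

Lemma sup_irr c d f g (hc : apart c f g) (hd : apart d f g) : c = d -> sup hc = sup hd.
Proof. by move=> e; apply: amap_eq => v /=; rewrite e. Qed.

Lemma apart_axis M M' s f g i : const_far M f -> const_far M' g ->
  (M + M' <= s)%N -> apart (axis i s) f g.
Proof.
by move=> hf hg hs; apply: (apart_coord (i := i) hf hg); rewrite /axis eqxx; lia.
Qed.

Lemma sup_up M M' s t f g i (hs : apart (axis i s) f g) (ht : apart (axis i t) f g) :
  const_far M f -> const_far M' g -> (M + M' <= s)%N -> (s <= t)%N ->
  ahomotopic (sup hs) (sup ht).
Proof.
move=> hf hg h1 h2.
have hc k : apart (axis i (s + k)%N) f g.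
  by apply: (apart_axis i hf hg); exact: leq_trans h1 (leq_addr _ _).
rewrite (@sup_irr _ _ _ _ hs (hc 0%N)) ?addn0 //.
rewrite (@sup_irr _ _ _ _ ht (hc (t - s)%N)) ?subnKC //.
apply: (sup_path hc) => k; apply: (@adj_coord _ _ i); rewrite /axis ?eqxx; first lia.
by move=> j /negbTE ->.
Qed.

Lemma sup_corner M M' s t f g i j
  (hs : apart (axis i s) f g) (ht : apart (axis j t) f g) :
  const_far M f -> const_far M' g -> (M + M' <= s)%N -> (M + M' <= t)%N ->
  i != j -> ahomotopic (sup hs) (sup ht).
Proof.
move=> hf hg h1 h2 ij.
pose c1 k := fun l : 'I_n => if l == i then s%:Z else if l == j then k%:Z else 0 : int.
pose c2 k := fun l : 'I_n => if l == i then (s - k)%N%:Z else if l == j then t%:Z else 0 : int.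
have ji : (j == i) = false by rewrite eq_sym; exact/negbTE.
have hc1 k : apart (c1 k) f g.
  by apply: (apart_coord (i := i) hf hg); rewrite /c1 eqxx; lia.
have hc2 k : apart (c2 k) f g.
  by apply: (apart_coord (i := j) hf hg); rewrite /c2 ji eqxx; lia.
have [_ _ tr] := ahomotopic_equiv n G.
apply: (tr _ (sup (hc1 t))).
  rewrite (@sup_irr _ _ _ _ hs (hc1 0%N)).
    apply: (sup_path hc1) => k; apply: (@adj_coord _ _ j); rewrite /c1 ?ji ?eqxx; first lia.
    by move=> l /negbTE ->.
  by apply: funext => l; rewrite /c1 /axis; case: eqP => // _; case: eqP.
rewrite (@sup_irr _ _ _ _ (hc1 t) (hc2 0%N)); last first.
  by apply: funext => l; rewrite /c1 /c2 subn0.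
rewrite (@sup_irr _ _ _ _ ht (hc2 s)).
  apply: (sup_path hc2) => k; apply: (@adj_coord _ _ i); rewrite /c2 ?eqxx; first lia.
  by move=> l /negbTE ->.
apply: funext => l; rewrite /c2 /axis subnn.
by have [->|_] := eqVneq l j; [rewrite ji | case: ifP].
Qed.

Lemma sup_axes f g i j s t (hs : apart (axis i s) f g) (ht : apart (axis j t) f g) M M' N N' :
  const_far M f -> const_far M' g -> (M + M' <= s)%N ->
  const_far N f -> const_far N' g -> (N + N' <= t)%N ->
  ahomotopic (sup hs) (sup ht).
Proof.
move=> h1 h2 h3 k1 k2 k3; have [_ sy tr] := ahomotopic_equiv n G.
have [ij|ij] := eqVneq i j.
  rewrite -{}ij in ht *; have hst : apart (axis i (s + t)%N) f g.
    by apply: (apart_axis i h1 h2); lia.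
  apply: (tr _ (sup hst)); first by apply: (sup_up _ _ h1 h2 h3); lia.
  by apply: sy; apply: (sup_up _ _ k1 k2 k3); lia.
have hst : apart (axis i (s + t)%N) f g by apply: (apart_axis i h1 h2); lia.
apply: (tr _ (sup hst)); first by apply: (sup_up _ _ h1 h2 h3); lia.
by apply: (sup_corner _ _ k1 k2) => //; lia.
Qed.

Lemma sup_stepl c f f' g (h : apart c f g) (h' : apart c f' g) :
  step f f' -> step (sup h) (sup h').
Proof.
move=> ff v /=.
have [fv|fv] := pselect (f v = pt G); have [fw|fw] := pselect (f' v = pt G).
- by rewrite !superpose_in.
- have [-> e] := superpose_out h' fw; rewrite superpose_in // e -fv; exact: ff.
- have [-> e] := superpose_out h fv; rewrite (superpose_in _ _ fw) e -fw; exact: ff.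
- have [-> _] := superpose_out h fv; have [-> _] := superpose_out h' fw; exact: ff.
Qed.

Lemma sup_stepr c f g g' (h : apart c f g) (h' : apart c f g') :
  step g g' -> step (sup h) (sup h').
Proof.
move=> gg v /=; have [fv|fv] := pselect (f v = pt G).
  by rewrite !superpose_in.
by have [-> _] := superpose_out h fv; have [-> _] := superpose_out h' fv.
Qed.
End Superpose.

Section Concat.
Variables (n : nat) (G : pgraph).
Implicit Types (f g h : amap n G) (i j : 'I_n).

Lemma concat_superpose i M M' f g : const_far M f -> const_far M' g ->
  concat i M M' f g = superpose (axis i (M + M')%N) f g.
Proof.
move=> hf hg; apply: funext => v; rewrite /concat.
have -> : upd i (v i - M%:Z - M'%:Z) v = fun j => v j - axis i (M + M')%N j.
  by apply: funext => j; rewrite /upd /axis; case: eqP => [->|_]; lia.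
rewrite /superpose; case: ltP => [lt|le]; case: asboolP => // fv.
- by case: fv; apply: hf; exists i; lia.
- by rewrite fv hg //; exists i; rewrite /axis eqxx; lia.
Qed.

Lemma concat_gmap i M M' f g : const_far M f -> const_far M' g ->
  @is_gmap (grid n) G (concat i M M' f g).
Proof.
move=> hf hg; rewrite concat_superpose //; apply: superpose_gmap.
exact: (apart_axis i hf hg).
Qed.

Lemma concat_far i M M' f g : const_far M f -> const_far M' g ->
  exists K, const_far K (concat i M M' f g).
Proof. by move=> hf hg; rewrite concat_superpose //; exact: superpose_far. Qed.

Definition concat_map i f g M M' (hf : const_far M f) (hg : const_far M' g) : amap n G :=
  @AMap n G (GMap (concat_gmap i hf hg)) (concat_far i hf hg).

Definition concat_class i f g : A_ n G :=
  class _ (concat_map i (proj2_sig (cid (amapP f))) (proj2_sig (cid (amapP g)))).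

Lemma concat_classE i j f g s (hs : apart (axis j s) f g) M M' :
  const_far M f -> const_far M' g -> (M + M' <= s)%N ->
  concat_class i f g = class _ (sup hs).
Proof.
move=> hf hg le; rewrite /concat_class.
case: cid => N /= kf; case: cid => N' /= kg; apply/A_E.
have ht : apart (axis i (N + N')%N) f g by exact: (apart_axis i kf kg).
have -> : concat_map i kf kg = sup ht.
  by apply: amap_eq => v; rewrite /= concat_superpose.
exact: (sup_axes _ _ kf kg (leqnn _) hf hg le).
Qed.

Lemma concat_class_eq i f f' g g' : ahomotopic f f' -> ahomotopic g g' ->
  concat_class i f g = concat_class i f' g'.
Proof.
move=> hf hg; transitivity (concat_class i f' g).
  apply: (ahomotopic_ind (F := fun f => concat_class i f g)) hf => {f f' g' hg} f f' ff.
  have [[M hf] [M2 hf'] [M' hg]] := And3 (amapP f) (amapP f') (amapP g).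
  have {}hf : const_far (M + M2)%N f by apply: const_far_le hf; exact: leq_addr.
  have {}hf' : const_far (M + M2)%N f' by apply: const_far_le hf'; exact: leq_addl.
  have h1 := apart_axis i hf hg (leqnn _); have h2 := apart_axis i hf' hg (leqnn _).
  rewrite (concat_classE i h1 hf hg) // (concat_classE i h2 hf' hg) //.
  by apply/A_E; apply: ahomotopic_step; exact: sup_stepl.
apply: (ahomotopic_ind (F := fun g => concat_class i f' g)) hg => {f g g' hf} g g' gg.
have [[M hf] [M' hg] [M2 hg']] := And3 (amapP f') (amapP g) (amapP g').
have {}hg : const_far (M' + M2)%N g by apply: const_far_le hg; exact: leq_addr.
have {}hg' : const_far (M' + M2)%N g' by apply: const_far_le hg'; exact: leq_addl.
have h1 := apart_axis i hf hg (leqnn _); have h2 := apart_axis i hf hg' (leqnn _).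
rewrite (concat_classE i h1 hf hg) // (concat_classE i h2 hf hg') //.
by apply/A_E; apply: ahomotopic_step; exact: sup_stepr.
Qed.

Definition amul_along i (a b : A_ n G) : A_ n G := concat_class i (repr a) (repr b).

Lemma amul_class i f g : amul_along i (class _ f) (class _ g) = concat_class i f g.
Proof. by apply: concat_class_eq; apply: repr_class; exact: ahomotopic_equiv. Qed.

Lemma amul_sup i f g s (hs : apart (axis i s) f g) M M' :
  const_far M f -> const_far M' g -> (M + M' <= s)%N ->
  amul_along i (class _ f) (class _ g) = class _ (sup hs).
Proof. by rewrite amul_class; exact: concat_classE. Qed.

Lemma amulA i : associative (amul_along i).
Proof.
move=> a b d; elim/quotP: a => f; elim/quotP: b => g; elim/quotP: d => h.
have [[M hf] [M1 hg] [M2 hh]] := And3 (amapP f) (amapP g) (amapP h).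
pose t := (M + M1 + M2)%N; pose s := (M + (M1 + M2 + t))%N.
have a1 : apart (axis i t) g h by apply: (apart_axis i hg hh); rewrite /t; lia.
have hax k j : `|axis i k j| <= k%:Z :> int by rewrite /axis; case: eqP; lia.
have k1 : const_far (M1 + M2 + t)%N (sup a1) by exact: superpose_const.
have a2 : apart (axis i s) f (sup a1) by apply: (apart_axis i hf k1).
have a3 : apart (axis i s) f g by apply: (apart_axis i hf hg); rewrite /s; lia.
have k2 : const_far (M + M1 + s)%N (sup a3) by exact: superpose_const.
have a4 : apart (axis i (s + t)%N) (sup a3) h.
  by apply: (apart_axis i k2 hh); rewrite /t; lia.
rewrite (amul_sup a1 hg hh); last by rewrite /t; lia.
rewrite (amul_sup a2 hf k1) // (amul_sup a3 hf hg); last by rewrite /s; lia.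
rewrite (amul_sup a4 k2 hh); last by rewrite /t; lia.
congr class; apply: amap_eq => v /=.
have [fv|fv] := pselect (f v = pt G).
  have e : (fun j => v j - axis i (s + t)%N j) = fun j => v j - axis i s j - axis i t j.
    by apply: funext => j; rewrite /axis; case: eqP; lia.
  by rewrite /superpose (asboolT fv) e.
by rewrite /superpose (asboolF fv) (asboolF fv).
Qed.

Lemma amul_1r i : right_id (A_base n G) (amul_along i).
Proof.
move=> a; elim/quotP: a => f; have [M hf] := amapP f.
have h0 : const_far 0%N (amap_const n G) by [].
have ha := apart_axis i hf h0 (leqnn _).
rewrite (amul_sup ha hf h0) //; congr class; apply: amap_eq => v.
by rewrite /= /superpose; case: asboolP.
Qed.

Lemma gmap_upd i (F : int -> int) : (forall x y, `|x - y| <= 1 -> `|F x - F y| <= 1) ->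
  @is_gmap (grid n) (grid n) (fun v => upd i (F (v i)) v).
Proof.
move=> hF v w; apply: adj_powP => [->//|k /adj_Iinf hk h].
apply: (@adj_coord _ _ _ k).
  rewrite /upd; case: eqP => [<-|_] //; exact: hF.
move=> j nj; rewrite /upd; case: eqP => [ji|_]; last exact: h.
by rewrite -ji h.
Qed.

Lemma amul_rinv i (a : A_ n G) : exists b, amul_along i a b = A_base n G.
Proof.
elim/quotP: a => f; have [M hf] := amapP f.
have rg : @is_gmap (grid n) G (fun v => f (upd i (- v i) v)).
  by move=> v w vw; apply: gmapP; apply: (@gmap_upd i (fun x => - x) _ v w vw) => x y; lia.
have rf : const_far M (fun v => f (upd i (- v i) v)).
  move=> v [j hj]; apply: hf; exists j; rewrite /upd; case: eqP => [e|_] //.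
  by rewrite normrN -e.
pose r : amap n G := @AMap n G (GMap rg) (ex_intro _ M rf).
exists (class _ r); have ha := apart_axis i hf (rf : const_far M r) (leqnn _).
rewrite (amul_sup ha hf (rf : const_far M r)) //; apply/A_E.
pose F t (x : int) : int := Num.min (Num.min x ((2 * M)%N%:Z - x)) (M%:Z - t%:Z).
have hg t : @is_gmap (grid n) G (fun v => f (upd i (F t (v i)) v)).
  move=> v w vw; apply: gmapP; apply: (@gmap_upd i (F t) _ v w vw) => x y.
  by rewrite /F; lia.
have hfar t : const_far (3 * M)%N (fun v => f (upd i (F t (v i)) v)).
  move=> v [j hj]; apply: hf; exists j; rewrite /upd; case: eqP => [e|_]; last by lia.
  by rewrite -e /F; lia.
pose s t : amap n G := @AMap n G (GMap (hg t)) (ex_intro _ (3 * M)%N (hfar t)).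
have -> : sup ha = s 0%N.
  apply: amap_eq => v; rewrite /= -(concat_superpose i hf (rf : const_far M r)) /concat /=.
  case: ltP => h; last first.
    congr (gmap_fun _ _); apply: funext => j; rewrite /upd; case: eqP => // -> .
    by rewrite /F; lia.
  congr (gmap_fun _ _); apply: funext => j; rewrite /upd eqxx; case: eqP => // _.
  by rewrite /F; lia.
have -> : amap_const n G = s (2 * M)%N.
  apply: amap_eq => v; rewrite /= hf //; exists i; rewrite /upd eqxx /F; lia.
apply: ahomotopic_seq => t v /=; apply: gmapP; apply: (@adj_coord _ _ _ i).
  by rewrite /upd eqxx /F; lia.
by move=> j nj; rewrite /upd (negbTE nj).
Qed.

Lemma amul_indep i j : amul_along i = amul_along j.
Proof.
apply: funext => a; apply: funext => b; elim/quotP: a => f; elim/quotP: b => g.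
have [[M hf] [M' hg]] := (amapP f, amapP g).
have ha := apart_axis j hf hg (leqnn _).
by rewrite !amul_class !(concat_classE _ ha hf hg).
Qed.

Lemma amul_inv i (a : A_ n G) :
  exists b, amul_along i b a = A_base n G /\ amul_along i a b = A_base n G.
Proof.
have [b hb] := amul_rinv i a; exists b; split=> //.
have [d hd] := amul_rinv i b.
rewrite -[LHS](amul_1r i) -[in LHS]hd (amulA i _ b d) -(amulA i b a b).
by rewrite hb amul_1r.
Qed.

Lemma amul_1l i : left_id (A_base n G) (amul_along i).
Proof.
move=> a; have [b [h1 h2]] := amul_inv i a.
by rewrite -h2 -amulA h1 amul_1r.
Qed.
End Concat.

Section AGroup.
Variables (n : nat) (G : pgraph).

Definition amul : A_ n.+1 G -> A_ n.+1 G -> A_ n.+1 G := amul_along ord0.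

Definition ainv (a : A_ n.+1 G) : A_ n.+1 G := proj1_sig (cid (amul_inv ord0 a)).

Lemma amul_Vl : left_inverse (A_base n.+1 G) ainv amul.
Proof. by move=> a; rewrite /ainv; case: cid => b []. Qed.
Lemma amul_Vr : right_inverse (A_base n.+1 G) ainv amul.
Proof. by move=> a; rewrite /ainv; case: cid => b []. Qed.
End AGroup.

HB.instance Definition _ n G := gen_eqMixin (A_ n G).
HB.instance Definition _ n G := gen_choiceMixin (A_ n G).
HB.instance Definition _ n G :=
  isGroup.Build (A_ n.+1 G) (@amulA n.+1 G ord0) (@amul_1l n.+1 G ord0)
    (@amul_1r n.+1 G ord0) (@amul_Vl n G) (@amul_Vr n G).

Lemma A_mulE n (G : pgraph) (i : 'I_n.+1) (f g : amap n.+1 G) M M'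
    (hf : const_far M f) (hg : const_far M' g) :
  ((class _ f : A_ n.+1 G) * (class _ g : A_ n.+1 G))%g = class _ (concat_map i hf hg).
Proof.
have ha := apart_axis i hf hg (leqnn _).
rewrite [LHS](_ : _ = concat_class ord0 f g); last exact: amul_class.
rewrite (concat_classE _ ha hf hg) //; congr class; apply: amap_eq => v.
by rewrite /= concat_superpose.
Qed.

Lemma hpi_mulE1 (X : pkan) (u v w : rcube 1 X) : prod_rel u v w ->
  ((class _ u : hpi 1 X) * (class _ v : hpi 1 X))%g = class _ w.
Proof. exact: hmul1E. Qed.

Lemma hpi_mulES n (X : pkan) (a b : hpi n.+2 X) :
  hpi_loop (a * b)%g = (hpi_loop a * hpi_loop b)%g.
Proof. exact: hpi_deloopK. Qed.

Section AMap.
Variables (n : nat) (G H : pgraph) (phi : pgmap G H).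

Lemma amap_push_subproof (f : amap n G) :
  exists M, const_far M (gmap_comp phi f).
Proof.
by have [M hM] := amapP f; exists M => v /hM /= ->; exact: pgmap_pt.
Qed.

Definition amap_push (f : amap n G) : amap n H := AMap (amap_push_subproof f).

Definition A_map (a : A_ n G) : A_ n H := class _ (amap_push (repr a)).

Lemma A_mapE f : A_map (class _ f) = class _ (amap_push f).
Proof.
rewrite /A_map; apply: (ahomotopic_ind (F := fun f => class _ (amap_push f))).
  by move=> g h gh; apply/A_E; apply: ahomotopic_step => v /=;
    apply: gmapP; exact: gh.
by apply: repr_class; exact: ahomotopic_equiv.
Qed.
End AMap.

Record pkan_map (X Y : pkan) : Type := PKanMap {
  pkan_cmap :> cmap X Y ; pkan_map_base : pkan_cmap 0 (base X) = base Y }.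

Section HpiMap.
Variables (n : nat) (X Y : pkan) (F : pkan_map X Y).

Lemma pkan_map_tdegen m : F m (tdegen m (base X)) = tdegen m (base Y).
Proof. by rewrite /tdegen cmapP pkan_map_base. Qed.

Lemma rcube_push_subproof (u : rcube n X) (i : 'I_n) e :
  face i e (F n u) = tdegen n.-1 (base Y).
Proof. by rewrite /face -cmapP -/(face _ _ _) rcubeP pkan_map_tdegen. Qed.

Definition rcube_push (u : rcube n X) : rcube n Y := RCube (rcube_push_subproof u).

Definition hpi_map (a : hpi n X) : hpi n Y := class _ (rcube_push (repr a)).

Lemma hpi_mapE u : hpi_map (class _ u) = class _ (rcube_push u).
Proof.
apply/classE; first exact: homotopic_equiv.
have [h [h0 h1 hh]] := repr_class u (@homotopic_equiv n X).
exists (F n.+1 h); rewrite /face -!cmapP; split.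
- by move: h0; rewrite /face => ->.
- by move: h1; rewrite /face => ->.
- by move=> i e ni; rewrite -cmapP -/(face _ _ _) hh // pkan_map_tdegen.
Qed.
End HpiMap.

Section NerveMap.
Variables (G H : pgraph) (phi : pgmap G H).

Lemma ncube_push_subproof n (f : ncube G n) : exists M, stable M (gmap_comp phi f).
Proof.
have [M hM] := ncubeP f; exists M; apply: clamp_stable => v /=.
by rewrite stable_clamp.
Qed.

Definition ncube_push n (f : ncube G n) : ncube H n := NCube (ncube_push_subproof f).

Lemma ncube_push_act m n (a : boxhom m n) (f : nerve G n) :
  ncube_push (act a f) = act a (ncube_push f : nerve H n).
Proof.
apply: ncube_eq => v; have [M hM] := ncubeP f.
have hM' : stable M (ncube_push f) by apply: clamp_stable => w /=; rewrite stable_clamp.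
by rewrite /= (nact_funE a hM) (@nact_funE _ _ _ a (ncube_push f) M hM').
Qed.

Lemma ncube_push_base : ncube_push (base (nerve G)) = base (nerve H).
Proof. by apply: ncube_eq => v /=; exact: pgmap_pt. Qed.

Definition nerve_map : pkan_map (nerve G) (nerve H) :=
  @PKanMap (nerve G) (nerve H) (@CMap (nerve G) (nerve H) ncube_push ncube_push_act)
    ncube_push_base.
End NerveMap.

(* Main.v *)
Require Import Defs.
From mathcomp Require Import all_boot.
From mathcomp Require Import all_order all_algebra zify boolp.

Set Implicit Arguments.
Unset Strict Implicit.
Unset Printing Implicit Defensive.
Import Order.TTheory GRing.Theory Num.Theory.

(** Why the theorem holds.  A relative n-cube of the nerve is a stable graph map
    from the grid to [G] whose faces are all constant at the base point, and
    by stability this says exactly that the map is constant at the base point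
    far from the origin.  So relative n-cubes and the maps representing classes
    of A_n are the same maps, and [rcube_of_amap] only repackages them.

    The two homotopy relations also agree ([homotopic_amap]).  Slicing an
    (n+1)-cube along its last coordinate gives a sequence of maps, each
    pointwise adjacent to the next, that is, a homotopy of finite length;
    stability bounds the number of slices that matter.  Conversely, a homotopy
    of finite length becomes stable in the new coordinate when it is continued
    by its end values in both directions.  Hence the bijection [A_hpi], which is
    natural because both sides act on representatives by postcomposition.

    For the products, unfolding the iterated loop space shows that
    [u] [v] = [w] as soon as some (n+2)-cube has u, v, w as faces in its last two
    directions and the base point as its other faces ([hpi_mul_cube]).  If f and
    g are constant outside radius M and fg is their concatenation along the last
    coordinate, such a cube for f, g, fg is obtained by letting the last
    coordinate of fg depend on two variables x, y through the 1-Lipschitz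
    function [corner].  On the sides x = -oo, y = +oo and x = +oo, this function
    runs through the part of fg that is f, through the part that is g, and
    through the constant part beyond them; on y = -oo it runs through all of
    fg. *)

(** * Faces of the nerve at the base point *)

Section NerveFaces.
Local Open Scope ring_scope.

Lemma nerve_tdegenE n (G : pgraph) (v : grid n) :
  (tdegen n (base (nerve G)) : ncube G n) v = pt G.
Proof. exact: (@nact_tdegen G n (base (nerve G)) v (fun _ => 0)). Qed.

(** Clamping keeps a far point far, and does not move the other points. *)
Lemma const_far_stable n (G : pgraph) M (f : ('I_n -> int) -> G) :
  const_far M f -> stable M f.
Proof.
move=> hf; apply: clamp_stable => v.
have [[i hi]|nfar] := pselect (far M v).
  by rewrite !hf //; [exists i|exists i; rewrite /clamp; lia].
congr f; apply: funext => j; apply: clamp_id.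
by have [//|hj] := boolP (- M%:Z <= v j <= M%:Z); case: nfar; exists j; lia.
Qed.

Variables (n : nat) (G : pgraph).

(** Together with [face_tdegen] below, this reads the condition that the faces in
    one direction are at the base point off the values of the map, without
    reference to operators. *)
Lemma face_tdegen_val M (f : ncube G n) (i : 'I_n) (v : 'I_n -> int) : stable M f ->
  (forall e, @face (nerve G) n i e f = tdegen n.-1 (base (nerve G))) ->
  M%:Z <= `|v i| -> f v = pt G.
Proof.
move=> hM hf hv; rewrite -(stable_clamp v hM); set w := fun j => _.
have := congr1 (fun q : ncube G n.-1 => q (del i w)) (hf (0 <= v i)).
rewrite nerve_tdegenE (nact_face _ _ hM) => <-.
rewrite -[in LHS](ins_del i w); congr (f (ins _ _ _)).
by rewrite /w /clamp; case: ifP => h; lia.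
Qed.

Lemma face_tdegen M (f : ncube G n) (i : 'I_n) e : stable M f ->
  (forall v : 'I_n -> int, M%:Z <= `|v i| -> f v = pt G) ->
  @face (nerve G) n i e f = tdegen n.-1 (base (nerve G)).
Proof.
move=> hM hf; apply: ncube_eq => v.
rewrite nerve_tdegenE (nact_face _ _ hM) hf // ins_same.
by case: e; lia.
Qed.
End NerveFaces.

(** * The comparison map *)

Section Comparison.
Local Open Scope ring_scope.

(** An edge of the grid changes a single coordinate.  If it is the last one, the
    point stays put and the index moves by at most one step of the sequence;
    otherwise both ends of the edge are handled by the same map of the
    sequence. *)
Lemma slices_gmap m (G : graph) (H : nat -> grid m -> G) (c : int -> nat) :
  (forall x y, `|x - y| <= 1 -> (c x = c y \/ c x = (c y).+1 \/ c y = (c x).+1)%N) ->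
  (forall k, is_gmap (H k)) ->
  (forall k v, adj (H k v) (H k.+1 v)) ->
  @is_gmap (grid m.+1) G (fun w => H (c (w ord_max)) (@del _ m.+1 ord_max w)).
Proof.
move=> hc hH hs v w vw; move: (vw); apply: adj_powP => [->//|k /adj_Iinf hk h].
have [ek|nk] := eqVneq k ord_max.
  have -> : @del _ m.+1 ord_max v = del ord_max w.
    by apply: funext => j; apply: h; rewrite ek eq_sym neq_lift.
  rewrite ek in hk; have [->//|[->|->]] := hc _ _ hk; last exact: hs.
  exact/adj_sym/hs.
rewrite (h ord_max); last by rewrite eq_sym.
by apply: hH; exact: (@gmap_del m.+1 ord_max v w vw).
Qed.

Variables (n : nat) (G : pgraph).
Implicit Types (f g : amap n G).

Lemma amap_stable f : exists M, stable M f.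
Proof. by have [M hf] := amapP f; exists M; exact: const_far_stable. Qed.

Definition amap_ncube f : ncube G n := NCube (amap_stable f).

Lemma amap_ncube_face f (i : 'I_n) e :
  @face (nerve G) n i e (amap_ncube f) = tdegen n.-1 (base (nerve G)).
Proof.
have [M hf] := amapP f.
apply: (@face_tdegen _ _ M); first exact: const_far_stable.
by move=> v hv; apply: hf; exists i.
Qed.

Definition rcube_of_amap f : rcube n (nerve G) :=
  @RCube n (nerve G) (amap_ncube f) (amap_ncube_face f).

Lemma rcube_far (u : rcube n (nerve G)) :
  exists M, const_far M (rcube_cell u : ncube G n).
Proof.
have [M hM] := ncubeP (rcube_cell u : ncube G n); exists M => v [i hi].
by apply: (face_tdegen_val hM _ hi) => e; exact: rcubeP.
Qed.

Definition amap_of_rcube (u : rcube n (nerve G)) : amap n G := AMap (rcube_far u).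

Lemma amap_of_rcubeK u : rcube_of_amap (amap_of_rcube u) = u.
Proof. by apply: rcube_eq; apply: ncube_eq. Qed.

(** A homotopy in the Kan complex lives on one more infinite direction, a homotopy
    of maps on a finite interval; stability is what makes the passage from the
    former to the latter possible. *)
Lemma homotopic_amap f g :
  homotopic (rcube_of_amap f) (rcube_of_amap g) <-> ahomotopic f g.
Proof.
split=> [[h [h0 h1 hh]]|/ahomotopicP [m [s [h0 h1 hs]]]].
  have [M hM] := ncubeP (h : ncube G n.+1).
  have hg k : @is_gmap (grid n) G
      (fun v => (h : ncube G n.+1) (@ins _ n.+1 ord_max (k%:Z - M%:Z) v)).
    by move=> v w vw; apply: gmapP; exact: (@gmap_ins n.+1 ord_max _ v w vw).
  have hf k : const_far M
      (fun v => (h : ncube G n.+1) (@ins _ n.+1 ord_max (k%:Z - M%:Z) v)).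
    move=> v [i hi]; apply: (@face_tdegen_val n.+1 G M h (lift ord_max i)) => //.
      by move=> e; apply: hh; rewrite eq_sym neq_lift.
    by rewrite (@ins_lift _ n.+1).
  (* Only the slices at heights -M to M are used, so heights are shifted by M. *)
  pose s k : amap n G := @AMap n G (GMap (hg k)) (ex_intro _ M (hf k)).
  have e0 : s 0%N = f.
    apply: amap_eq => v; have := congr1 (fun q : ncube G n => q v) h0.
    rewrite (@nact_face G n.+1 _ _ _ _ hM) /= => <-.
    by rewrite sub0r.
  have e1 : s M.*2 = g.
    apply: amap_eq => v; have := congr1 (fun q : ncube G n => q v) h1.
    rewrite (@nact_face G n.+1 _ _ _ _ hM) /= => <-.
    by congr (ncube_map h (ins _ _ _)); lia.
  rewrite -e0 -e1; apply: ahomotopic_seq => k v /=; apply: gmapP.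
  apply: (@adj_coord _ _ _ ord_max); first by rewrite !(@ins_same _ n.+1); lia.
  by move=> j nj; rewrite /ins; case: unliftP nj => // ->; rewrite eqxx.
(* The bound m makes the cube below stable in its last coordinate, the other
   bounds make it stable in the remaining ones. *)
have [K hK] := choice (fun k => amapP (s k)).
pose M := maxn m (\max_(k < m.+1) K k).
have hM k : const_far M (s (minn k m)).
  have hk : (minn k m < m.+1)%N by rewrite ltnS geq_minr.
  apply: const_far_le (hK _); apply: leq_trans (leq_maxr _ _).
  exact: (leq_bigmax (Ordinal hk)).
pose c (x : int) : nat := `|Num.max (0 : int) x|%N.
have sP k : step (s (minn k m)) (s (minn k.+1 m)).
  have [lt|ge] := ltnP k m; first by rewrite (minn_idPl lt); exact: hs.
  by rewrite (minn_idPr (leqW ge)).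
have hg : @is_gmap (grid n.+1) G
    (fun w => s (minn (c (w ord_max)) m) (@del _ n.+1 ord_max w)).
  apply: (@slices_gmap n G (fun k => s (minn k m))).
  - by rewrite /c => x y; lia.
  - by move=> k v w; exact: gmapP.
  - by move=> k v; exact: sP.
have hst : stable M
    (fun w : grid n.+1 => s (minn (c (w ord_max)) m) (@del _ n.+1 ord_max w)).
  apply: clamp_stable => v.
  have -> : minn (c (clamp M (v ord_max))) m = minn (c (v ord_max)) m.
    by rewrite /c /clamp /M; lia.
  exact: (@stable_clamp _ _ M _ (@del _ n.+1 ord_max v) (const_far_stable (@hM _))).
pose h : ncube G n.+1 := @NCube G n.+1 (GMap hg) (ex_intro _ M hst).
exists h; split.
- apply: ncube_eq => v; rewrite (@nact_face G n.+1 _ _ h M hst) /= -h0.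
  rewrite (@ins_same _ n.+1) (@del_ins _ n.+1).
  by have -> : minn (c (- M%:Z)) m = 0%N by rewrite /c; lia.
- apply: ncube_eq => v; rewrite (@nact_face G n.+1 _ _ h M hst) /= -h1.
  rewrite (@ins_same _ n.+1) (@del_ins _ n.+1).
  by have -> : minn (c M%:Z) m = m by rewrite /c /M; lia.
- move=> i e; case: (unliftP ord_max i) => [j|] ->; last by rewrite eqxx.
  move=> _; apply: (@face_tdegen n.+1 G M h) => // v hv.
  by apply: hM; exists j.
Qed.

Definition A_hpi (a : A_ n G) : hpi n (nerve G) :=
  class _ (rcube_of_amap (Defs.repr a)).

Lemma A_hpiE f : A_hpi (class _ f) = class _ (rcube_of_amap f).
Proof.
apply/classE; first exact: homotopic_equiv.
by apply/homotopic_amap; apply: Defs.repr_class; exact: ahomotopic_equiv.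
Qed.

Lemma A_hpi_bij : bijective A_hpi.
Proof.
exists (fun a => class _ (amap_of_rcube (Defs.repr a))) => a; elim/Defs.quotP: a.
  move=> f; rewrite A_hpiE; apply/A_E/homotopic_amap; rewrite amap_of_rcubeK.
  by apply: Defs.repr_class; exact: homotopic_equiv.
by move=> u; rewrite A_hpiE amap_of_rcubeK Defs.reprK.
Qed.

Lemma A_hpi_base : A_hpi (A_base n G) = hpi_base n (nerve G).
Proof.
rewrite A_hpiE; congr class; apply: rcube_eq; apply: ncube_eq => v.
by rewrite nerve_tdegenE.
Qed.
End Comparison.

Lemma A_hpi_map n (G H : pgraph) (phi : pgmap G H) (a : A_ n G) :
  A_hpi (A_map phi a) = hpi_map (nerve_map phi) (A_hpi a).
Proof.
elim/Defs.quotP: a => f; rewrite A_mapE !A_hpiE hpi_mapE; congr class.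
by apply: rcube_eq; apply: ncube_eq.
Qed.

(** * The product, read on the last two coordinates *)

Definition penult n : 'I_n.+2 := widen_ord (leqnSn n.+1) ord_max.

(** Each passage to the loop complex removes the first coordinate, so that the
    square defining the product on the fundamental group of the iterated loop
    complex is a cube of [X] seen through its last two coordinates. *)
Lemma hpi_mul_cube n (X : pkan) (u v w : rcube n.+1 X) (h : X n.+2) :
  @face X n.+2 (penult n) false h = u ->
  @face X n.+2 (penult n) true h = tdegen n.+1 (base X) ->
  @face X n.+2 ord_max true h = v -> @face X n.+2 ord_max false h = w ->
  (forall i e, i != penult n -> i != ord_max ->
    @face X n.+2 i e h = tdegen n.+1 (base X)) ->
  ((class _ u : hpi n.+1 X) * (class _ v : hpi n.+1 X))%g = class _ w.
Proof.
elim: n X u v w h => [|n IH] X u v w h h1 h2 h3 h4 hh.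
  have p0 : penult 0 = ord0 by apply: val_inj.
  rewrite p0 in h1 h2; apply: hpi_mulE1; exists h; split=> //.
  by rewrite h2 (rcubeP v); apply/esym/act_tdegen.
have lp : penult n.+1 = lift ord0 (penult n) by apply: val_inj.
have lm : @ord_max n.+2 = lift ord0 (@ord_max n.+1) by apply: val_inj.
have hl e : @face X n.+3 ord0 e h = tdegen n.+2 (base X) by apply: hh.
apply: (can_inj (@hpi_loopK _ _)); rewrite hpi_mulES !hpi_loopE.
apply: (IH (loop X) _ _ _ (exist _ h hl)).
- by apply: sig_eq; rewrite loop_face -lp.
- by apply: sig_eq; rewrite loop_face -lp h2 loop_tdegen.
- by apply: sig_eq; rewrite loop_face -lm.
- by apply: sig_eq; rewrite loop_face -lm.
- move=> i e i1 i2; apply: sig_eq; rewrite loop_face loop_tdegen.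
  by apply: hh; rewrite ?lp ?lm (inj_eq (@lift_inj _ _)).
Qed.

Section ConnLast.
Local Open Scope ring_scope.
Variable n : nat.
Variable op : int -> int -> int.

(** [conn op ord_max] is the connection of the last two coordinates, with an
    arbitrary operation instead of a maximum or a minimum. *)
Lemma conn_last (x : 'I_n.+2 -> int) :
  conn op ord_max x = upd ord_max (op (x (penult n)) (x ord_max)) (@del _ n.+2 ord_max x).
Proof.
have lm : lift ord0 (@ord_max n) = @ord_max n.+1 by apply: val_inj.
by apply: funext => j; rewrite /conn /upd lm.
Qed.

Lemma conn_ins_penult a v :
  conn op ord_max (@ins _ n.+2 (penult n) a v) = upd ord_max (op a (v ord_max)) v.
Proof.
have lp : @ord_max n.+1 = lift (penult n) ord_max.
  by apply: val_inj; rewrite /= /bump; lia.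
rewrite conn_last ins_same {1}lp ins_lift.
apply: funext => j; rewrite /upd; case: eqP => // nj.
have lj : lift ord_max j = lift (penult n) j.
  have hj : j <> n :> nat by move=> e; apply: nj; exact: val_inj.
  by apply: val_inj; rewrite /= /bump; have := ltn_ord j; lia.
by rewrite /del lj ins_lift.
Qed.

Lemma conn_ins_last a v :
  conn op ord_max (@ins _ n.+2 ord_max a v) = upd ord_max (op (v ord_max) a) v.
Proof.
have lp : penult n = lift ord_max ord_max by apply: val_inj; rewrite /= /bump; lia.
by rewrite conn_last ins_same del_ins lp ins_lift.
Qed.
End ConnLast.

(** * The cube exhibiting a concatenation as a product *)

Section Product.
Local Open Scope ring_scope.
Variables (n : nat) (G : pgraph).

Lemma gmap_conn_last (op : int -> int -> int) :
  (forall x x' y, `|x - x'| <= 1 -> `|op x y - op x' y| <= 1) ->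
  (forall x y y', `|y - y'| <= 1 -> `|op x y - op x y'| <= 1) ->
  @is_gmap (grid n.+2) (grid n.+1) (conn op ord_max).
Proof.
move=> hx hy v w vw; rewrite !conn_last; move: (vw).
apply: adj_powP => [->//|k /adj_Iinf hk h].
have pm : penult n != ord_max by apply/eqP => /(congr1 val) /=; lia.
have [ek|nk] := eqVneq k ord_max.
  apply: (@adj_coord _ _ _ ord_max).
    by rewrite /upd eqxx (h (penult n)) ?ek // hy // -ek.
  move=> j nj; rewrite /upd (negbTE nj); apply: h.
  by rewrite ek eq_sym neq_lift.
have [ep|np] := eqVneq k (penult n).
  apply: (@adj_coord _ _ _ ord_max).
    by rewrite /upd eqxx (h ord_max) ?ep 1?eq_sym // hx // -ep.
  move=> j nj; rewrite /upd (negbTE nj); apply: h; rewrite ep.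
  apply: contra nj => /eqP /(congr1 val) /= ej; apply/eqP/val_inj => /=.
  by move: ej; rewrite /bump; lia.
rewrite !(h ord_max) 1?eq_sym // !(h (penult n)) 1?eq_sym //.
case: (unliftP ord_max k) nk => [k' ek _|->]; last by rewrite eqxx.
apply: (@adj_coord _ _ _ k').
  rewrite /upd; case: eqP => [_|_]; first by lia.
  by rewrite /del -ek.
move=> j nj; rewrite /upd; case: eqP => [//|_]; apply: h.
by rewrite ek (inj_eq (@lift_inj _ _)).
Qed.

(** The parameter of the concatenation of two maps of radius M, which is the first
    map up to M, the second one, shifted by 2M, from M on, and constant up to
    -M and from 3M on.  The first argument of the maximum covers the side
    x = -oo, where the parameter stops at the junction M.  The second one is x
    itself on the side y = -oo; as y grows it is shifted to x + 2M, the parameter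
    of the second map. *)
Definition corner (M : nat) (x y : int) : int :=
  Num.max (Num.min y M%:Z) (x + Num.max 0 (Num.min (2 * M)%N%:Z (y + M%:Z))).

(** This makes the concatenation with parameter [corner] stable: when clamping
    changes the parameter, it does so inside one of the two regions where the
    concatenation is constant. *)
Lemma corner_clamp M x y (x' := clamp (3 * M) x) (y' := clamp (3 * M) y) :
  corner M x' y' = corner M x y \/
  (corner M x' y' <= - M%:Z /\ corner M x y <= - M%:Z) \/
  (3 * M%:Z <= corner M x' y' /\ 3 * M%:Z <= corner M x y).
Proof.
(* The dependence on y changes at -M and at M. *)
have low a b : b <= - M%:Z -> corner M a b = Num.max b a by rewrite /corner; lia.
have mid a b : - M%:Z <= b <= M%:Z -> corner M a b = Num.max b (a + b + M%:Z).
  by rewrite /corner; lia.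
have high a b : M%:Z <= b -> corner M a b = Num.max M%:Z (a + (2 * M)%N%:Z).
  by rewrite /corner; lia.
have [h|h] := lerP y (- M%:Z).
  by rewrite !low; rewrite /x' /y' /clamp; lia.
have [h'|h'] := lerP y M%:Z.
  by rewrite !mid; rewrite /x' /y' /clamp; lia.
by rewrite !high; rewrite /x' /y' /clamp; lia.
Qed.

Lemma corner_gmap M : @is_gmap (grid n.+2) (grid n.+1) (conn (corner M) ord_max).
Proof. by apply: gmap_conn_last => x y z; rewrite /corner; lia. Qed.

Variables (M : nat) (f g : amap n.+1 G).
Hypotheses (hf : const_far M f) (hg : const_far M g).

Let fg : amap n.+1 G := concat_map ord_max hf hg.

Lemma upd_id (v : 'I_n.+1 -> int) : upd ord_max (v ord_max) v = v.
Proof. by apply: funext => k; rewrite /upd; case: eqP => [->|]. Qed.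

Lemma concat_far_init v (j : 'I_n.+1) : j != ord_max -> M%:Z <= `|v j| -> fg v = pt G.
Proof.
move=> nj hv; rewrite /= /concat; case: ifP => _; first by apply: hf; exists j.
by apply: hg; exists j; rewrite /upd (negbTE nj).
Qed.

Lemma concat_low (t : int) v : t <= M%:Z -> fg (upd ord_max t v) = f (upd ord_max t v).
Proof. by move=> ht; rewrite /= /concat /upd eqxx ht. Qed.

Lemma concat_high (t : int) v : M%:Z <= t ->
  fg (upd ord_max t v) = g (upd ord_max (t - M%:Z - M%:Z) v).
Proof.
move=> ht; rewrite /= /concat {1}/upd eqxx; case: leP => [le|_].
  have -> : t = M%:Z by lia.
  by rewrite hf ?hg //; exists ord_max; rewrite /upd eqxx; lia.
congr (amap_map g _); apply: funext => j; rewrite /upd eqxx.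
by case: eqP.
Qed.

Lemma concat_pt (t : int) v : t <= - M%:Z \/ 3 * M%:Z <= t -> fg (upd ord_max t v) = pt G.
Proof.
case=> ht.
  by rewrite concat_low ?hf //; [exists ord_max; rewrite /upd eqxx; lia|lia].
by rewrite concat_high ?hg //; [exists ord_max; rewrite /upd eqxx; lia|lia].
Qed.

Lemma concat_const_far : const_far (3 * M)%N fg.
Proof.
move=> v [j hj]; have [ej|nj] := eqVneq j ord_max; last first.
  by apply: (concat_far_init nj); lia.
rewrite -(upd_id v); apply: concat_pt; move: hj; rewrite ej; lia.
Qed.

Lemma corner_stable : stable (3 * M)%N (fun w => fg (conn (corner M) ord_max w)).
Proof.
apply: clamp_stable => w; rewrite !conn_last.
set x := w (penult n); set y := w ord_max; set v := @del _ n.+2 ord_max w.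
transitivity (fg (upd ord_max (corner M x y) (fun j => clamp (3 * M) (v j)))).
  have [->//|[[h1 h2]|[h1 h2]]] := corner_clamp M x y.
    by rewrite !concat_pt //; left.
  by rewrite !concat_pt //; right.
have st := const_far_stable concat_const_far.
rewrite -[LHS](stable_clamp _ st) -[RHS](stable_clamp _ st); congr (gmap_fun _ _).
apply: funext => j; rewrite /upd; case: eqP => // _.
by rewrite clamp_id // clamp_bnd.
Qed.

Definition product_cube : ncube G n.+2 :=
  @NCube G n.+2 (gmap_comp fg (GMap (@corner_gmap M)))
    (ex_intro (fun K => stable K _) _ corner_stable).

Lemma corner_left v : fg (upd ord_max (corner M (- (3 * M)%N%:Z) (v ord_max)) v) = f v.
Proof.
have [h|h] := lerP (v ord_max) (- M%:Z).
  rewrite concat_pt; last by left; rewrite /corner; lia.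
  by rewrite hf //; exists ord_max; lia.
rewrite concat_low; last by rewrite /corner; lia.
have [h'|h'] := lerP (v ord_max) M%:Z.
  have -> : corner M (- (3 * M)%N%:Z) (v ord_max) = v ord_max by rewrite /corner; lia.
  by rewrite upd_id.
rewrite !hf //; first by exists ord_max; lia.
by exists ord_max; rewrite /upd eqxx /corner; lia.
Qed.

Lemma corner_right y v : fg (upd ord_max (corner M (3 * M)%N%:Z y) v) = pt G.
Proof. by apply: concat_pt; right; rewrite /corner; lia. Qed.

Lemma corner_top v : fg (upd ord_max (corner M (v ord_max) (3 * M)%N%:Z) v) = g v.
Proof.
rewrite concat_high; last by rewrite /corner; lia.
have [h|h] := lerP (- M%:Z) (v ord_max).
  have -> : corner M (v ord_max) (3 * M)%N%:Z - M%:Z - M%:Z = v ord_max.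
    by rewrite /corner; lia.
  by rewrite upd_id.
rewrite !hg //; first by exists ord_max; lia.
by exists ord_max; rewrite /upd eqxx /corner; lia.
Qed.

Lemma corner_bottom v : fg (upd ord_max (corner M (v ord_max) (- (3 * M)%N%:Z)) v) = fg v.
Proof.
rewrite -[in RHS](upd_id v); have [h|h] := lerP (- M%:Z) (v ord_max).
  by congr (fg (upd _ _ _)); rewrite /corner; lia.
by rewrite !concat_pt //; left; rewrite /corner; lia.
Qed.

(** The four sides of [product_cube] in the last two directions are computed by
    [corner_left], [corner_right], [corner_top] and [corner_bottom]; its other
    faces stay far from the origin in a coordinate that [corner] leaves alone. *)
Lemma amap_product :
  ((class _ (rcube_of_amap f) : hpi n.+1 (nerve G)) * class _ (rcube_of_amap g))%g
  = class _ (rcube_of_amap fg).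
Proof.
have faceE i e (v : 'I_n.+1 -> int) :
    (@face (nerve G) n.+2 i e product_cube : ncube G n.+1) v =
    fg (conn (corner M) ord_max
          (ins i (if e then (3 * M)%N%:Z else - (3 * M)%N%:Z) v)).
  by rewrite (@nact_face G n.+2 _ _ product_cube _ corner_stable).
apply: (@hpi_mul_cube n (nerve G) _ _ _ product_cube).
- by apply: ncube_eq => v; rewrite faceE conn_ins_penult corner_left.
- by apply: ncube_eq => v; rewrite faceE conn_ins_penult corner_right nerve_tdegenE.
- by apply: ncube_eq => v; rewrite faceE conn_ins_last corner_top.
- by apply: ncube_eq => v; rewrite faceE conn_ins_last corner_bottom.
- move=> i e ip im; apply: (@face_tdegen n.+2 G (3 * M) product_cube).
    exact: corner_stable.
  move=> v hv /=; rewrite -/(fg _).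
  case: (unliftP ord_max i) im ip hv => [j ->|->]; last by rewrite eqxx.
  move=> _ jp hv; apply: (@concat_far_init _ j).
    by apply: contra jp => /eqP ->; apply/eqP/val_inj; rewrite /= /bump; lia.
  rewrite conn_last /upd; case: eqP => [ej|_]; last by rewrite /del; lia.
  by case/eqP: jp; rewrite ej; apply: val_inj; rewrite /= /bump; lia.
Qed.
End Product.

Lemma A_hpi_mul n (G : pgraph) :
  {morph @A_hpi n.+1 G : a b / (a * b)%g >-> (a * b)%g}.
Proof.
move=> a b; elim/Defs.quotP: a => f; elim/Defs.quotP: b => g.
have [[M1 hf] [M2 hg]] := (amapP f, amapP g).
(* The construction of the cube uses one radius for both maps. *)
have {}hf : const_far (maxn M1 M2) f by apply: const_far_le hf; exact: leq_maxl.
have {}hg : const_far (maxn M1 M2) g by apply: const_far_le hg; exact: leq_maxr.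
by rewrite (A_mulE ord_max hf hg) !A_hpiE -amap_product.
Qed.

Theorem theorem4p6 :
  (exists phi : forall G : pgraph, A_ 0 G -> hpi 0 (nerve G),
     [/\ forall G : pgraph, bijective (phi G),
         forall G : pgraph, phi G (A_base 0 G) = hpi_base 0 (nerve G) &
         forall (G H : pgraph) (f : pgmap G H) (a : A_ 0 G),
           phi H (A_map f a) = hpi_map (nerve_map f) (phi G a)]) /\
  (forall n : nat,
   exists phi : forall G : pgraph, A_ n.+1 G -> hpi n.+1 (nerve G),
     [/\ forall G : pgraph, bijective (phi G),
         forall G : pgraph, {morph phi G : a b / (a * b)%g >-> (a * b)%g} &
         forall (G H : pgraph) (f : pgmap G H) (a : A_ n.+1 G),
           phi H (A_map f a) = hpi_map (nerve_map f) (phi G a)]).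
Proof.
split=> [|n]; exists (fun G => @A_hpi _ G); split; intros.
- exact: A_hpi_bij.
- exact: A_hpi_base.
- exact: A_hpi_map.
- exact: A_hpi_bij.
- exact: A_hpi_mul.
- exact: A_hpi_map.
Qed.
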